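(* Let $k$ be a field of characteristic zero, let $n\ge 2$, and let $0\neq f\in S=k[x_1,\ldots,x_n]$. Then: (i) $V(f)$ is smooth if and only if $\mathcal{E}_f=0$. (ii) Let $p\in\mathbb{A}^n_k$ be a rational isolated singular point of $V(f)$ and let $\mathfrak{p}\subset S$ denote its defining prime ideal. Then $V(f)$ has a quasihomogeneous singularity at $p$ if and only if $(\mathcal{E}_f)_{\mathfrak{p}}$ is a cyclic $S_{\mathfrak{p}}$-module.
   Context: Write $f_i=\partial f/\partial x_i$, $J_f=\langle f_1,\ldots,f_n\rangle\subset S$ and $I_f=\langle f,f_1,\ldots,f_n\rangle\subset S$. $V(f)$ is smooth means $I_f=S$; the singular locus of $V(f)$ is the closed set defined by $I_f$, and a singular point $p$ is isolated if it is an isolated point of this locus, i.e. $(I_f)_{\mathfrak p}$ is primary to the maximal ideal of $S_{\mathfrak p}$. A rational point is a point of $k^n$, so $\mathfrak{p}=\langle x_1-p_1,\ldots,x_n-p_n\rangle$ with $p_i\in k$. $V(f)$ is said to have a quasihomogeneous singularity at the singular point $p$ if $(J_f)_{\mathfrak p}=(I_f)_{\mathfrak p}$ in $S_{\mathfrak p}$. $\mathrm{Der}_k(S)$ is the module of $k$-derivations of $S$, free on $\partial/\partial x_1,\ldots,\partial/\partial x_n$. The module of logarithmic derivations is $\mathrm{Derlog}_S(f)=\{\eta\in\mathrm{Der}_k(S) : \eta(f)\in fS\}$. The Koszul derivations are the elements $$\left\{ f_i\frac{\partial}{\partial x_j}-f_j\frac{\partial}{\partial x_i} : 1\le i,j\le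 n\right\}\cup\left\{ f\frac{\partial}{\partial x_i} : 1\le i\le n\right\}$$ of $\mathrm{Derlog}_S(f)$. The module of essential derivations $\mathcal{E}_f$ is the quotient of $\mathrm{Derlog}_S(f)$ by the $S$-submodule generated by the Koszul derivations. *)

(* Defs.v *)
From HB Require Import structures.
From mathcomp Require Import all_boot all_order all_algebra.
From mathcomp Require Import boolp.
From mathcomp Require Import mpoly ring.

Set Implicit Arguments.
Unset Strict Implicit.
Unset Printing Implicit Defensive.

Import GRing.Theory.

Local Open Scope ring_scope.
Local Open Scope quotient_scope.

Section Span.
Variables (R : comNzRingType) (M : lmodType R).
Implicit Type A : M -> Prop.

Definition span A : {pred M} := fun x =>
  `[< exists r (c : 'I_r -> R) (a : 'I_r -> M),
        (forall i, A (a i)) /\ x = \sum_i c i *: a i >].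

Lemma spanP A x :
  reflect (exists r (c : 'I_r -> R) (a : 'I_r -> M),
             (forall i, A (a i)) /\ x = \sum_i c i *: a i) (x \in span A).
Proof. exact: asboolP. Qed.

Lemma span_submod_closed A : submod_closed (span A).
Proof.
split=> [|b x y /spanP[r [c [a [Aa ->]]]] /spanP[s [d [e [Ae ->]]]]]; apply/spanP.
  exists 0, (fun=> 0), (fun=> 0); split; first by case.
  by rewrite big_ord0.
exists (r + s)%N, (fun i => match split i with inl j => b * c j | inr j => d j end),
  (fun i => match split i with inl j => a j | inr j => e j end).
split=> [i|]; first by case: split.
rewrite big_split_ord scaler_sumr; congr (_ + _); apply: eq_bigr => i _.
  by rewrite (unsplitK (inl i)) scalerA.
by rewrite (unsplitK (inr i)).
Qed.

HB.instance Definition _ A :=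
  GRing.isSubmodClosed.Build R M (span A) (span_submod_closed A).

Lemma mem_span A x : A x -> x \in span A.
Proof.
move=> Ax; apply/spanP; exists 1%N, (fun=> 1), (fun=> x).
by rewrite big_ord1 scale1r.
Qed.

Lemma span_least A (N : submodClosed M) :
  (forall x, A x -> x \in N) -> {subset span A <= N}.
Proof.
by move=> AN x /spanP[r [c [a [Aa ->]]]]; apply: rpred_sum => i _; apply/rpredZ/AN.
Qed.

End Span.

Definition gen_ideal (R : comNzRingType) (A : R -> Prop) : {pred R} :=
  @span R R^o A.

Section GenIdeal.
Variables (R : comNzRingType) (A : R -> Prop).

Fact gen_ideal_zmod_closed : zmod_closed (gen_ideal A).
Proof.
have [A0 AD] := @span_submod_closed R R^o A; split=> // x y xA yA.
by have := AD (-1) y x yA xA; rewrite scaleN1r addrC.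
Qed.

HB.instance Definition _ :=
  GRing.isZmodClosed.Build R (gen_ideal A) gen_ideal_zmod_closed.

Lemma gen_idealMl a x : x \in gen_ideal A -> a * x \in gen_ideal A.
Proof.
have [A0 AD] := @span_submod_closed R R^o A => xA.
by have := AD a x 0 xA A0; rewrite addr0.
Qed.

Lemma gen_idealP x :
  reflect (exists r (c a : 'I_r -> R),
             (forall i, A (a i)) /\ x = \sum_i c i * a i) (x \in gen_ideal A).
Proof. exact: asboolP. Qed.

Lemma mem_gen_ideal x : A x -> x \in gen_ideal A.
Proof. exact: (@mem_span R R^o A x). Qed.

End GenIdeal.

Section QuotientModule.
Variables (R : comNzRingType) (M : lmodType R) (N : submodClosed M).

(* The library's submodules over a semiring are not closed under opposite by
   construction; over a ring they are, as needed by [Quotient.quot]. *)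
Definition submod_pred : {pred M} := N.

Fact submod_pred_zmod_closed : zmod_closed submod_pred.
Proof.
split=> [|x y xN yN]; first exact: (rpred0 N).
by rewrite -scaleN1r; apply: (@rpredD _ N) => //; apply: (@rpredZ _ _ N).
Qed.

HB.instance Definition _ :=
  GRing.isZmodClosed.Build M submod_pred submod_pred_zmod_closed.

Definition quotmod := Quotient.quot submod_pred.

HB.instance Definition _ := GRing.Zmodule.on quotmod.
HB.instance Definition _ := EqQuotient.on quotmod.

Definition quotmod_scale (a : R) (x : quotmod) : quotmod :=
  \pi_quotmod (a *: repr x).

Lemma quotmod_piP (x y : M) : (\pi_quotmod x = \pi_quotmod y) <-> (x - y \in N).
Proof.
have -> : (x - y \in N) = (x == y %[mod quotmod]).
  exact: (Quotient.idealrBE submod_pred).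
by split=> /eqP.
Qed.

Lemma quotmod_piD (x y : M) :
  \pi_quotmod (x + y) = \pi_quotmod x + \pi_quotmod y.
Proof. by rewrite (Quotient.pi_add submod_pred). Qed.

Lemma quotmod_piZ a (x : M) :
  \pi_quotmod (a *: x) = quotmod_scale a (\pi_quotmod x).
Proof.
apply/quotmod_piP; rewrite -scalerBr; apply: rpredZ.
by apply/quotmod_piP; rewrite reprK.
Qed.

Lemma quotmodW (Q : quotmod -> Prop) :
  (forall x : M, Q (\pi_quotmod x)) -> forall x, Q x.
Proof. by move=> QP x; rewrite -[x]reprK. Qed.

Fact quotmod_scaleA a b x :
  quotmod_scale a (quotmod_scale b x) = quotmod_scale (a * b) x.
Proof.
elim/quotmodW: x => x.
by rewrite -!quotmod_piZ scalerA.
Qed.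

Fact quotmod_scale1 : left_id 1 quotmod_scale.
Proof. by elim/quotmodW => x; rewrite -quotmod_piZ scale1r. Qed.

Fact quotmod_scaleDr : right_distributive quotmod_scale +%R.
Proof.
move=> a; elim/quotmodW => x; elim/quotmodW => y.
by rewrite -quotmod_piD -!quotmod_piZ scalerDr quotmod_piD.
Qed.

Fact quotmod_scaleDl x : {morph quotmod_scale^~ x : a b / a + b}.
Proof. move: x; elim/quotmodW => x a b.
by rewrite -!quotmod_piZ scalerDl quotmod_piD. Qed.

HB.instance Definition _ := GRing.Zmodule_isLmodule.Build R quotmod
  quotmod_scaleA quotmod_scale1 quotmod_scaleDr quotmod_scaleDl.

End QuotientModule.

Definition cyclic_module (R : comNzRingType) (M : lmodType R) : Prop :=
  exists m : M, forall x : M, exists a : R, x = a *: m.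

Section Localization.
Variables (R : comNzRingType) (P : prime_idealr R).

Record denom := Denom { den_val : R; denP : den_val \notin (P : {pred R}) }.

HB.instance Definition _ := [isSub for den_val].
HB.instance Definition _ := [Choice of denom by <:].

Lemma denom1_subproof : 1 \notin (P : {pred R}).
Proof. by rewrite idealr1. Qed.
Definition denom1 : denom := Denom denom1_subproof.

Lemma denomM_subproof (s t : denom) : den_val s * den_val t \notin (P : {pred R}).
Proof. by rewrite prime_idealrM negb_or !denP. Qed.
Definition denomM (s t : denom) : denom := Denom (denomM_subproof s t).

Section Module.
Variable M : lmodType R.

Definition locrel (x y : M * denom) : bool :=
  `[< exists u : denom,
        den_val u *: (den_val y.2 *: x.1) = den_val u *: (den_val x.2 *: y.1) >].

Lemma locrel_equiv : equiv_class_of locrel.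
Proof.
split=> [[m s]|[m s] [m' s']|[m2 s2] [m1 s1] [m3 s3]].
- by apply/asboolP; exists denom1.
- by apply/asboolP/asboolP => -[u uE]; exists u.
move=> /asboolP[u /= uE] /asboolP[v /= vE]; apply/asboolP.
exists (denomM (denomM u v) s2) => /=; rewrite !scalerA.
have -> : den_val u * den_val v * den_val s2 * den_val s3
    = den_val v * den_val s3 * (den_val u * den_val s2).
  by ring.
rewrite -[LHS]scalerA -[in LHS](scalerA (den_val u)) uE !scalerA.
have -> : den_val v * den_val s3 * den_val u * den_val s1
    = den_val u * den_val s1 * (den_val v * den_val s3).
  by ring.
rewrite -[LHS]scalerA -[in LHS](scalerA (den_val v)) vE !scalerA; congr (_ *: _).
by ring.
Qed.

Canonical locrel_equiv_rel := EquivRelPack locrel_equiv.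
Canonical locrel_encModRel := defaultEncModRel locrel.

Definition locmod := {eq_quot locrel}.

HB.instance Definition _ : EqQuotient _ locrel locmod := EqQuotient.on locmod.
HB.instance Definition _ := Choice.on locmod.

Definition locfrac (m : M) (s : denom) : locmod := \pi_locmod (m, s).

Lemma locfracP m s m' s' :
  locfrac m s = locfrac m' s' <->
  exists u : denom,
    den_val u *: (den_val s' *: m) = den_val u *: (den_val s *: m').
Proof.
split=> [/eqmodP/asboolP[u uE]|[u uE]]; first by exists u.
by apply/eqmodP/asboolP; exists u.
Qed.

Lemma locfracE (x : locmod) : {ms | x = locfrac ms.1 ms.2}.
Proof. by exists (repr x); rewrite /locfrac -surjective_pairing reprK. Qed.

Definition loc_zero : locmod := locfrac 0 denom1.
Definition loc_opp (x : locmod) : locmod := locfrac (- (repr x).1) (repr x).2.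
Definition loc_add (x y : locmod) : locmod :=
  locfrac (den_val (repr y).2 *: (repr x).1 + den_val (repr x).2 *: (repr y).1)
          (denomM (repr x).2 (repr y).2).

Lemma repr_locfrac m s : exists u : denom,
  den_val u *: (den_val s *: (repr (locfrac m s)).1)
    = den_val u *: (den_val (repr (locfrac m s)).2 *: m).
Proof.
by apply/locfracP; rewrite /locfrac -surjective_pairing reprK.
Qed.

Lemma loc_oppE m s : loc_opp (locfrac m s) = locfrac (- m) s.
Proof.
have [u uE] := repr_locfrac m s; apply/locfracP; exists u.
by rewrite !scalerN uE.
Qed.

Lemma loc_addE m s m' s' :
  loc_add (locfrac m s) (locfrac m' s')
    = locfrac (den_val s' *: m + den_val s *: m') (denomM s s').
Proof.
have [u] := repr_locfrac m s; have [v] := repr_locfrac m' s'.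
rewrite /loc_add; move: (repr _) (repr _) => -[n t] [n' t'] /= vE uE.
apply/locfracP; exists (denomM u v) => /=.
rewrite !scalerDr !scalerA; congr (_ + _).
  have -> : den_val u * den_val v * (den_val s * den_val s') * den_val t'
      = (den_val v * den_val s' * den_val t') * (den_val u * den_val s) by ring.
  rewrite -[LHS]scalerA -[in LHS](scalerA (den_val u)) uE !scalerA.
  by congr (_ *: _); ring.
have -> : den_val u * den_val v * (den_val s * den_val s') * den_val t
    = (den_val u * den_val s * den_val t) * (den_val v * den_val s') by ring.
by rewrite -[LHS]scalerA -[in LHS](scalerA (den_val v)) vE !scalerA; congr (_ *: _); ring.
Qed.


Lemma locmodW (Q : locmod -> Prop) :
  (forall m s, Q (locfrac m s)) -> forall x, Q x.
Proof. by move=> QP x; have [[m s] ->] := locfracE x. Qed.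

Fact loc_addA : associative loc_add.
Proof.
elim/locmodW => x s; elim/locmodW => y t; elim/locmodW => z u.
rewrite !loc_addE; apply/locfracP; exists denom1 => /=; rewrite !scale1r.
rewrite !scalerDr !scalerA addrA; congr (_ *: _ + _ *: _ + _ *: _); ring.
Qed.

Fact loc_addC : commutative loc_add.
Proof.
elim/locmodW => x s; elim/locmodW => y t.
rewrite !loc_addE addrC; apply/locfracP; exists denom1 => /=.
by rewrite [den_val t * den_val s]mulrC.
Qed.

Fact loc_add0 : left_id loc_zero loc_add.
Proof.
elim/locmodW => x s; rewrite loc_addE; apply/locfracP; exists denom1 => /=.
by rewrite scaler0 add0r mul1r !scale1r.
Qed.

Fact loc_addN : left_inverse loc_zero loc_opp loc_add.
Proof.
elim/locmodW => x s; rewrite loc_oppE loc_addE; apply/locfracP; exists denom1.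
by rewrite scalerN addNr !scaler0.
Qed.

HB.instance Definition _ :=
  GRing.isZmodule.Build locmod loc_addA loc_addC loc_add0 loc_addN.

Lemma locfracD m s m' s' :
  locfrac m s + locfrac m' s'
    = locfrac (den_val s' *: m + den_val s *: m') (denomM s s').
Proof. exact: loc_addE. Qed.

End Module.

Definition locring := locmod R^o.

HB.instance Definition _ := GRing.Zmodule.on locring.

Section Scale.
Variable M : lmodType R.

(* [(a / s) . (m / t) = (a m) / (s t)] *)
Definition loc_scale (x : locring) (y : locmod M) : locmod M :=
  locfrac (((repr x).1 : R) *: (repr y).1) (denomM (repr x).2 (repr y).2).

Lemma loc_scaleE (a : R^o) s (m : M) t :
  loc_scale (locfrac a s) (locfrac m t) = locfrac ((a : R) *: m) (denomM s t).
Proof.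
have [u] := repr_locfrac a s; have [v] := repr_locfrac m t.
rewrite /loc_scale; move: (repr _) (repr _) => -[b s'] [n t'] /= vE uE.
have {}uE : den_val u * (den_val s * b) = den_val u * (den_val s' * a) by exact: uE.
apply/locfracP; exists (denomM u v) => /=; rewrite !scalerA.
have -> : den_val u * den_val v * (den_val s * den_val t) * b
    = (den_val u * (den_val s * b)) * (den_val v * den_val t) by ring.
rewrite uE -[LHS]scalerA -[in LHS](scalerA (den_val v)) vE !scalerA.
by congr (_ *: _); ring.
Qed.

End Scale.

Definition loc_one : locring := @locfrac R^o 1 denom1.
Definition loc_mul (x y : locring) : locring := @loc_scale R^o x y.

Lemma loc_mulE (a b : R) s t :
  loc_mul (@locfrac R^o a s) (@locfrac R^o b t)
    = @locfrac R^o (a * b) (denomM s t).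
Proof. exact: loc_scaleE. Qed.

Lemma locring_addE (a b : R) s t :
  @locfrac R^o a s + @locfrac R^o b t
    = @locfrac R^o (den_val t * a + den_val s * b) (denomM s t).
Proof. exact: locfracD. Qed.

Fact loc_scaleA (M : lmodType R) x y (z : locmod M) :
  loc_scale x (loc_scale y z) = loc_scale (loc_mul x y) z.
Proof.
move: x y z; elim/locmodW => a s; elim/locmodW => b t; elim/locmodW => m u.
rewrite loc_mulE (loc_scaleE b t m u) !loc_scaleE.
apply/locfracP; exists denom1 => /=.
by rewrite !scale1r !scalerA; congr (_ *: _); ring.
Qed.

Fact loc_scale1 (M : lmodType R) : left_id loc_one (@loc_scale M).
Proof.
elim/locmodW => m u; rewrite loc_scaleE; apply/locfracP; exists denom1 => /=.
by rewrite mul1r !scale1r.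
Qed.

Fact loc_scaleDr (M : lmodType R) : right_distributive (@loc_scale M) +%R.
Proof.
elim/locmodW => a s; elim/locmodW => m t; elim/locmodW => n u.
rewrite locfracD !loc_scaleE locfracD; apply/locfracP; exists denom1 => /=.
by rewrite !scale1r !scalerDr !scalerA; congr (_ *: _ + _ *: _); ring.
Qed.

Fact loc_scaleDl (M : lmodType R) (z : locmod M) :
  {morph (@loc_scale M)^~ z : x y / x + y}.
Proof.
move: z; elim/locmodW => m u; elim/locmodW => a s; elim/locmodW => b t.
rewrite locring_addE !loc_scaleE locfracD; apply/locfracP; exists denom1 => /=.
by rewrite !scale1r !scalerA -!scalerDl !scalerA; congr (_ *: _); ring.
Qed.

Fact loc_mulC : commutative loc_mul.
Proof.
elim/locmodW => a s; elim/locmodW => b t.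
rewrite !loc_mulE mulrC; congr locfrac.
by apply: val_inj; rewrite /= mulrC.
Qed.

Fact loc_one_neq0 : loc_one != 0.
Proof.
apply/eqP => /locfracP[u uE].
have {}uE : den_val u * (1 * 1) = den_val u * (1 * 0) by exact: uE.
by have := denP u; rewrite -[den_val u]mulr1 -[1]mulr1 uE mul1r mulr0 rpred0.
Qed.

HB.instance Definition _ := GRing.Zmodule_isComNzRing.Build locring
  (@loc_scaleA R^o) loc_mulC (@loc_scale1 R^o)
  (fun x y z => @loc_scaleDl R^o z x y) loc_one_neq0.

HB.instance Definition _ (M : lmodType R) :=
  GRing.Zmodule_isLmodule.Build locring (locmod M)
    (@loc_scaleA M) (@loc_scale1 M) (@loc_scaleDr M) (@loc_scaleDl M).

Lemma locfracZ (M : lmodType R) (a : R^o) s (m : M) t :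
  (locfrac a s : locring) *: locfrac m t = locfrac ((a : R) *: m) (denomM s t).
Proof. exact: loc_scaleE. Qed.

(* the extension [I_P] of [I] to [R_P] *)
Definition locideal (I : {pred R}) (x : locring) : Prop :=
  exists (a : R^o) s, (a : R) \in I /\ x = locfrac a s.

End Localization.

(* [Q] is assumed to be an ideal; the last clause says that its radical is [m]. *)
Definition primary_to (R : comNzRingType) (m Q : R -> Prop) : Prop :=
  [/\ ~ Q 1,
      forall a b, Q (a * b) -> Q a \/ exists j, Q (b ^+ j)
    & forall a, m a <-> exists j, Q (a ^+ j)].

Section Derivations.
Variables (k : comNzRingType) (A : comAlgType k).

Definition derivation (d : A -> A) : Prop :=
  linear d /\ forall a b, d (a * b) = d a * b + a * d b.

Record der := Der { der_fun :> A -> A; derP : derivation der_fun }.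

HB.instance Definition _ := gen_eqMixin der.
HB.instance Definition _ := gen_choiceMixin der.

Lemma derE (d e : der) : d =1 e -> d = e.
Proof.
case: d e => [d dP] [e eP] /= /funext de.
by move: dP eP; rewrite de => dP eP; congr Der; exact: Prop_irrelevance.
Qed.

Fact der_zero_subproof : derivation (fun=> 0).
Proof. by split=> [c a b|a b]; rewrite ?scaler0 ?mul0r ?mulr0 addr0. Qed.

Fact der_opp_subproof (d : der) : derivation (fun a => - d a).
Proof.
by have [dl dM] := derP d; split=> [c a b|a b];
  rewrite ?dl ?dM opprD -?scalerN // mulNr mulrN.
Qed.

Fact der_add_subproof (d e : der) : derivation (fun a => d a + e a).
Proof.
have [[dl dM] [el eM]] := (derP d, derP e); split=> [c a b|a b].
  by rewrite dl el scalerDr addrACA.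
by rewrite dM eM mulrDl mulrDr addrACA.
Qed.

Fact der_scale_subproof (c : A) (d : der) : derivation (fun a => c * d a).
Proof.
have [dl dM] := derP d; split=> [b x y|x y].
  by rewrite dl mulrDr scalerAr.
by rewrite dM mulrDr mulrA [x * (c * _)]mulrCA.
Qed.

Definition der_zero := Der der_zero_subproof.
Definition der_opp d := Der (der_opp_subproof d).
Definition der_add d e := Der (der_add_subproof d e).
Definition der_scale c d := Der (der_scale_subproof c d).

Fact der_addA : associative der_add.
Proof. by move=> d e h; apply: derE => a /=; rewrite addrA. Qed.
Fact der_addC : commutative der_add.
Proof. by move=> d e; apply: derE => a /=; rewrite addrC. Qed.
Fact der_add0 : left_id der_zero der_add.
Proof. by move=> d; apply: derE => a /=; rewrite add0r. Qed.
Fact der_addN : left_inverse der_zero der_opp der_add.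
Proof. by move=> d; apply: derE => a /=; rewrite addNr. Qed.

HB.instance Definition _ :=
  GRing.isZmodule.Build der der_addA der_addC der_add0 der_addN.

Fact der_scaleA b c d : der_scale b (der_scale c d) = der_scale (b * c) d.
Proof. by apply: derE => a /=; rewrite mulrA. Qed.
Fact der_scale1 : left_id 1 der_scale.
Proof. by move=> d; apply: derE => a /=; rewrite mul1r. Qed.
Fact der_scaleDr : right_distributive der_scale +%R.
Proof. by move=> c d e; apply: derE => a /=; rewrite mulrDr. Qed.
Fact der_scaleDl d : {morph der_scale^~ d : b c / b + c}.
Proof. by move=> b c; apply: derE => a /=; rewrite mulrDl. Qed.

HB.instance Definition _ := GRing.Zmodule_isLmodule.Build A der
  der_scaleA der_scale1 der_scaleDr der_scaleDl.

Lemma der_addE (d e : der) a : (d + e) a = d a + e a. Proof. by []. Qed.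
Lemma der_oppE (d : der) a : (- d) a = - d a. Proof. by []. Qed.
Lemma der_scaleE c (d : der) a : (c *: d) a = c * d a. Proof. by []. Qed.

Definition derlog_pred (f : A) : {pred der} :=
  fun d => `[< exists g, d f = f * g >].

Lemma derlog_predP f (d : der) :
  reflect (exists g, d f = f * g) (d \in derlog_pred f).
Proof. exact: asboolP. Qed.

Fact derlog_submod_closed f : submod_closed (derlog_pred f).
Proof.
split=> [|c d e /derlog_predP[g dE] /derlog_predP[h eE]]; apply/derlog_predP.
  by exists 0; rewrite mulr0.
by exists (c * g + h); rewrite der_addE der_scaleE dE eE mulrDr mulrCA.
Qed.

HB.instance Definition _ f :=
  GRing.isSubmodClosed.Build A der (derlog_pred f) (derlog_submod_closed f).

Definition derlog (f : A) := {d : der | d \in derlog_pred f}.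

HB.instance Definition _ f := SubChoice.on (derlog f).
HB.instance Definition _ f := [SubChoice_isSubLmodule of derlog f by <:].

End Derivations.

Section Hypersurface.
Variables (k : fieldType) (n : nat).
Local Notation S := {mpoly k[n]}.

Lemma mpoly_alg_ind (Q : S -> Prop) :
  (forall c, Q c%:MP) -> (forall i, Q 'X_i) ->
  (forall a b, Q a -> Q b -> Q (a + b)) ->
  (forall a b, Q a -> Q b -> Q (a * b)) -> forall a, Q a.
Proof.
move=> QC QX QD QM; elim/mpolyind => [|c m a _ _ Qa]; first by rewrite -mpolyC0.
apply: QD => //; rewrite -mul_mpolyC; apply: (QM _ _ (QC c)).
rewrite (mpolyXE _ (perm.perm_one _) m); under eq_bigr do rewrite perm.permE.
elim/big_ind: _ => [|a1 a2|i _]; [by rewrite -mpolyC1| exact: QM|].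
elim: (m i) => [|e IHe]; first by rewrite expr0 -mpolyC1.
by rewrite exprS; apply: QM.
Qed.

Fact partial_subproof (i : 'I_n) : derivation (mderiv i : S -> S).
Proof. by split=> [c a b|a b]; rewrite ?mderivD ?mderivZ // mderivM. Qed.

Definition partial (i : 'I_n) : der S := Der (partial_subproof i).

Lemma partial_coord (c : 'I_n -> S) i : (\sum_j c j *: partial j) 'X_i = c i.
Proof.
suff -> : (\sum_j c j *: partial j) 'X_i = \sum_j c j * ('X_i)^`M(j).
  rewrite (bigD1 i) //= big1 => [|j ji]; rewrite mderivX mnm1E.
    by rewrite eqxx scale1r -[X in (X - _)%MM]add0m addmK mpolyX0 mulr1 addr0.
  by rewrite eq_sym (negPf ji) scale0r mulr0.
by elim/big_ind2: _ => // d1 a1 d2 a2 <- <-.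
Qed.

(* [Der_k(S)] is free on the [partial i] *)
Lemma partial_free (c d : 'I_n -> S) :
  \sum_i c i *: partial i = \sum_i d i *: partial i -> c =1 d.
Proof. by move=> cd i; rewrite -(partial_coord c) cd partial_coord. Qed.

Lemma der_coordE (d : der S) : d = \sum_i d 'X_i *: partial i.
Proof.
apply/eqP; rewrite -subr_eq0; apply/eqP; set e := _ - _.
have eX i : e 'X_i = 0 by rewrite /e der_addE der_oppE partial_coord subrr.
have [el eM] := derP e.
have e1 : e 1 = 0.
  have /eqP := eM 1 1; rewrite !mulr1 mul1r -subr_eq0 opprD addrA subrr add0r.
  by rewrite oppr_eq0 => /eqP.
have e0 : e 0 = 0.
  by have := eM 0 0; rewrite !(mul0r, mulr0) addr0.
apply: derE => a; rewrite [RHS]/=; elim/mpoly_alg_ind: a => [c|//|a b|a b].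
- by rewrite -[c%:MP]mulr1 mul_mpolyC -[_ *: _]addr0 el e1 e0 scaler0 addr0.
- by move=> ea eb; rewrite -[a]scale1r el ea eb scaler0 addr0.
- by move=> ea eb; rewrite eM ea eb mul0r mulr0 addr0.
Qed.

Implicit Type f : S.

Definition jacobian_ideal f : {pred S} :=
  gen_ideal (fun g => exists i, g = f^`M(i)).

Definition singular_ideal f : {pred S} :=
  gen_ideal (fun g => g = f \/ exists i, g = f^`M(i)).

Definition smooth_hypersurface f : Prop := forall g, g \in singular_ideal f.

Definition koszul f (d : derlog f) : Prop :=
  (exists i j, val d = f^`M(i) *: partial j - f^`M(j) *: partial i)
  \/ (exists i, val d = f *: partial i).

Lemma koszul_derlog f i j :
  (f^`M(i) *: partial j - f^`M(j) *: partial i \in derlog_pred f)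
  && (f *: partial i \in derlog_pred f).
Proof.
apply/andP; split; apply/derlog_predP.
  exists 0; rewrite mulr0 der_addE der_oppE !der_scaleE /=.
  by rewrite mulrC subrr.
by exists f^`M(i).
Qed.

Definition essder f : lmodType S := quotmod (span (@koszul f)).

Section Point.
Variable p : 'I_n -> k.

Definition point_ideal : {pred S} :=
  gen_ideal (fun g => exists i, g = 'X_i - (p i)%:MP).

Lemma mem_point_ideal g : (g \in point_ideal) = (g.@[p] == 0).
Proof.
apply/idP/eqP => [/gen_idealP[r [c [a [aE ->]]]]|g0].
  rewrite raddf_sum big1 // => i _; have [j ->] := aE i.
  by rewrite [LHS](mevalM p) mevalB mevalXU mevalC subrr mulr0.
suff : g - (g.@[p])%:MP \in point_ideal by rewrite g0 mpolyC0 subr0.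
rewrite /point_ideal; elim/mpoly_alg_ind: {g0}g => [c|i|a b aI bI|a b aI bI].
- by rewrite mevalC subrr rpred0.
- by rewrite mevalXU; apply: mem_gen_ideal; exists i.
- by rewrite mevalD mpolyCD opprD addrACA rpredD.
have -> : a * b - ((a * b).@[p])%:MP
    = a * (b - (b.@[p])%:MP) + (b.@[p])%:MP * (a - (a.@[p])%:MP).
  by rewrite mevalM mpolyCM; ring.
by rewrite rpredD ?gen_idealMl.
Qed.

Fact point_ideal_closed : idealr_closed point_ideal.
Proof.
split; rewrite ?mem_point_ideal ?meval0 ?meval1 ?oner_eq0 // => a u v.
rewrite !mem_point_ideal => /eqP u0 /eqP v0.
by rewrite mevalD mevalM u0 v0 mulr0 addr0.
Qed.

Fact point_ideal_prime : prime_idealr_closed point_ideal.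
Proof. by move=> u v; rewrite !mem_point_ideal mevalM mulf_eq0. Qed.

HB.instance Definition _ := isIdealr.Build S point_ideal point_ideal_closed.
HB.instance Definition _ :=
  isPrimeIdealrClosed.Build S point_ideal point_ideal_prime.

(* [point_ideal] extended to the local ring is its maximal ideal. *)
Definition isolated_singular_point f : Prop :=
  {subset singular_ideal f <= point_ideal} /\
  primary_to (@locideal S point_ideal point_ideal)
    (@locideal S point_ideal (singular_ideal f)).

Definition quasihomogeneous_at f : Prop :=
  forall x, @locideal S point_ideal (jacobian_ideal f) x
    <-> @locideal S point_ideal (singular_ideal f) x.

End Point.
End Hypersurface.

(* Main.v *)
(* Since [f] is a nonzerodivisor, a logarithmic derivation [eta] is the same as a
   syzygy [(eta X_1, .., eta X_n, - eta f / f)] of [f_1, .., f_n, f], and [essder f]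
   is the first homology of the Koszul complex on these [n + 1] elements.

   (i) This homology is annihilated by the ideal the elements generate. Conversely, if
   it vanishes, the elements are quasi-regular; but [n + 1] polynomials in [n]
   variables are algebraically dependent over [k], so they generate the unit ideal.

   (ii) Work in the local ring at [p], where the ideal contains powers of the
   [X_i - p_i], so that the Koszul homology on [m] generators vanishes above degree
   [m - n]. If [f] lies in the Jacobian ideal, [f_1, .., f_n] have no first homology,
   and the syzygy expressing [f] generates. Conversely let [a] generate the first
   homology. Its entries coming from derivations vanish at [p], because the singular
   ideal is stable under logarithmic derivations. If the remaining entry is a unit, [f]
   is in the Jacobian ideal. Otherwise, on the exterior algebra of the free module of
   rank [n + 1], the differential "contraction with the generators plus exterior
   product with [a]" squares to zero and is exact: in degree 0 because duality makes
   the first homology faithful over the quotient ring, in degree 1 because [a]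
   generates, and above by vanishing. Exactness survives reduction modulo the regular
   sequence [X_i - p_i], where this differential becomes zero: a contradiction. *)
Require Import Defs.
From HB Require Import structures.
From mathcomp Require Import all_boot all_order all_algebra.
From mathcomp Require Import boolp.
From mathcomp Require Import mpoly ring zify.
Import GRing.Theory.
Local Open Scope ring_scope.
Set Implicit Arguments.
Unset Strict Implicit.
Unset Printing Implicit Defensive.

(** * Koszul complexes *)

Section RegularSequence.
Variable R : comNzRingType.
Implicit Types (M : lmodType R) (y : nat -> R).

(** Membership in (y_0, .., y_{j-1})M, peeling off the last generator first, so that induction on
    [j] mirrors passing to the quotients one element at a time. *)
Fixpoint yspan y M (j : nat) (z : M) : Prop :=
  if j is j'.+1 then exists c : M, yspan y j' (z - y j' *: c) else z = 0.

Lemma yspan0 y M j : yspan y j (0 : M).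
Proof. by elim: j => //= j IHj; exists 0; rewrite scaler0 subr0. Qed.

Lemma yspanZD y M j (a : R) (u v : M) :
  yspan y j u -> yspan y j v -> yspan y j (a *: u + v).
Proof.
elim: j u v => [|j IHj] u v /=; first by move=> -> ->; rewrite scaler0 addr0.
move=> [c uc] [d vd]; exists (a *: c + d).
have -> : a *: u + v - y j *: (a *: c + d) =
  a *: (u - y j *: c) + (v - y j *: d).
  by rewrite scalerDr scalerBr opprD !scalerA mulrC addrACA.
exact: IHj.
Qed.

Lemma yspanD y M j (u v : M) : yspan y j u -> yspan y j v -> yspan y j (u + v).
Proof. by move=> uY vY; rewrite -[u]scale1r; apply: yspanZD. Qed.

Lemma yspanZ y M j a (u : M) : yspan y j u -> yspan y j (a *: u).
Proof. by move=> uY; rewrite -[_ *: _]addr0; apply/yspanZD/yspan0. Qed.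

Lemma yspanN y M j (u : M) : yspan y j u -> yspan y j (- u).
Proof. by rewrite -scaleN1r; apply: yspanZ. Qed.

Lemma yspanB y M j (u v : M) : yspan y j u -> yspan y j v -> yspan y j (u - v).
Proof. by move=> uY vY; apply/yspanD/yspanN. Qed.

Lemma yspan_sum y M j I (s : seq I) (P : pred I) (u : I -> M) :
  (forall i, P i -> yspan y j (u i)) -> yspan y j (\sum_(i <- s | P i) u i).
Proof.
move=> uY; elim/big_rec: _ => [|i v Pi]; first exact: yspan0.
by apply: yspanD; apply: uY.
Qed.

Lemma yspan_gen y M j i (c : M) : (i < j)%N -> yspan y j (y i *: c).
Proof.
elim: j => // j IHj; rewrite ltnS leq_eqVlt => /predU1P[->|/IHj ij] /=.
  by exists c; rewrite subrr; apply: yspan0.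
by exists 0; rewrite scaler0 subr0.
Qed.

Lemma yspan_linear y M M' (h : {linear M -> M'}) j u :
  yspan y j u -> yspan y j (h u).
Proof.
elim: j u => [|j IHj] u /=; first by move=> ->; rewrite linear0.
by move=> [c uc]; exists (h c); rewrite -linearZ -linearB; apply: IHj.
Qed.

Lemma yspan_scale y M j (r : R) (u : M) :
  @yspan y R^o j r -> yspan y j (r *: u).
Proof.
elim: j r => [|j IHj] r /=; first by move=> ->; rewrite scale0r.
by move=> [c /IHj rY]; exists (c *: u); rewrite scalerA -scalerBl.
Qed.

Lemma yspan_pair y M M' j (u : M) (v : M') :
  yspan y j ((u, v) : M * M') <-> yspan y j u /\ yspan y j v.
Proof.
elim: j u v => [|j IHj] u v /=; first by split=> [[-> ->]|[-> ->]].
split=> [[[c d]] /IHj[uc vd]|[[c uc] [d vd]]]; first by split; [exists c | exists d].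
by exists (c, d); apply/IHj.
Qed.

Definition regular y (n : nat) M :=
  forall j (z : M), (j < n)%N -> yspan y j (y j *: z) -> yspan y j z.

End RegularSequence.

(** * The exterior algebra of a free module and its two differentials *)

Section Exterior.
Variable R : comNzRingType.

(* [ext m] is the exterior algebra of [R^m]; a pair [(u, v)] stands for
   [u + e_m ^ v]. *)
Fixpoint ext (m : nat) : lmodType R :=
  if m is m'.+1 then ((ext m' * ext m')%type : lmodType R) else (R^o : lmodType R).

(** The Koszul differential: the antiderivation sending the basis vector of index k to [f k]. The
    signs here and in [wedge] come from moving past e_m. *)
Fixpoint contract (f : nat -> R) m : ext m -> ext m :=
  match m with
  | 0 => fun=> 0
  | m'.+1 => fun z => (contract f z.1 + f m' *: z.2, - contract f z.2)
  end.

Fixpoint wedge (w : nat -> R) m : ext m -> ext m :=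
  match m with
  | 0 => fun=> 0
  | m'.+1 => fun z => (wedge w z.1, w m' *: z.1 - wedge w z.2)
  end.

Fixpoint degpart (i : nat) m : ext m -> ext m :=
  match m with
  | 0 => fun z => if i is 0 then z else 0
  | m'.+1 => fun z => (degpart i z.1, if i is i'.+1 then degpart i' z.2 else 0)
  end.

Fixpoint ext_one m : ext m := if m is m'.+1 then (ext_one m', 0) else (1 : R).
Fixpoint ext_top m : ext m := if m is m'.+1 then (0, ext_top m') else (1 : R).

Fact contract_linear f m : linear (@contract f m).
Proof.
elim: m => [|m IHm] a u v /=; first by rewrite scaler0 addr0.
congr pair => /=; rewrite IHm.
  by rewrite !scalerDr !scalerA [f m * a]mulrC addrACA.
by rewrite opprD -scalerN.
Qed.
HB.instance Definition _ f m := GRing.isLinear.Build R (ext m) (ext m) _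
  (@contract f m) (@contract_linear f m).

Lemma contractD f m : {morph @contract f m : u v / u + v}.
Proof. exact: linearD. Qed.
Lemma contractZ f m r : {morph @contract f m : u / r *: u}.
Proof. exact: linearZ. Qed.

Fact wedge_linear w m : linear (@wedge w m).
Proof.
elim: m => [|m IHm] a u v /=; first by rewrite scaler0 addr0.
congr pair => /=; rewrite IHm //.
by rewrite scalerDr scalerBr !scalerA mulrC opprD addrACA.
Qed.
HB.instance Definition _ w m := GRing.isLinear.Build R (ext m) (ext m) _
  (@wedge w m) (@wedge_linear w m).

Lemma wedgeZ w m r : {morph @wedge w m : u / r *: u}.
Proof. exact: linearZ. Qed.

Fact degpart_linear i m : linear (@degpart i m).
Proof.
elim: m i => [|m IHm] [|i] a u v //=; first by rewrite scaler0 addr0.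
- by congr pair => /=; rewrite ?IHm // scaler0 addr0.
- by congr pair => /=; rewrite !IHm.
Qed.
HB.instance Definition _ i m := GRing.isLinear.Build R (ext m) (ext m) _
  (@degpart i m) (@degpart_linear i m).


Lemma contractK f m (z : ext m) : contract f (contract f z) = 0.
Proof.
elim: m z => [|m IHm] z //=.
rewrite !(linearD, linearN, linearZ) /= !IHm.
by rewrite add0r scalerN subrr !oppr0.
Qed.

Lemma wedgeK w m (z : ext m) : wedge w (wedge w z) = 0.
Proof.
elim: m z => [|m IHm] z //=.
rewrite !(linearD, linearN, linearZ) /= !IHm.
by rewrite scalerN !oppr0 addr0 subrr.
Qed.

(** Exterior multiplication by [w] is a null-homotopy of multiplication by \sum w_k f_k; hence the
    ideal generated by [f] kills Koszul homology. *)
Lemma contract_wedge f w m (z : ext m) :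
  contract f (wedge w z) + wedge w (contract f z) = (\sum_(k < m) w k * f k) *: z.
Proof.
elim: m z => [|m IHm] z /=; first by rewrite big_ord0 scale0r addr0.
case: z => u v; rewrite big_ord_recr /=.
rewrite !(linearD, linearN, linearZ) /=; congr pair => /=.
  rewrite scalerA scalerDl -IHm scalerN addrACA.
  by rewrite subrK.
rewrite !opprK scalerN scalerA scalerDl -IHm mulrC.
by rewrite -[X in _ + X]addrA addrACA addNr add0r [X in _ + X]addrC addrA.
Qed.

Lemma contract_degpart0 f m (z : ext m) : contract f (degpart 0 z) = 0.
Proof.
by elim: m z => [|m IHm] z //=; rewrite IHm scaler0 addr0 linear0 oppr0.
Qed.

Lemma degpart_contract i f m (z : ext m) :
  degpart i (contract f z) = contract f (degpart i.+1 z).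
Proof.
elim: m i z => [|m IHm] i z /=; first by case: i.
rewrite !(linearD, linearN, linearZ) /= IHm; congr pair => /=.
by case: i => [|i]; rewrite ?contract_degpart0 ?oppr0 // linearN /= IHm.
Qed.

Lemma degpart0_wedge w m (z : ext m) : degpart 0 (wedge w z) = 0.
Proof. by elim: m z => [|m IHm] z //=; rewrite IHm. Qed.

Lemma degpart_wedge i w m (z : ext m) :
  degpart i.+1 (wedge w z) = wedge w (degpart i z).
Proof.
elim: m i z => [|m IHm] i z //=.
rewrite IHm; congr pair => /=.
case: i => [|i]; rewrite linearB linearZ /=; last by rewrite IHm.
by rewrite degpart0_wedge !linear0.
Qed.

Lemma degpart_id i j m (z : ext m) :
  degpart i (degpart j z) = if i == j then degpart j z else 0.
Proof.
elim: m i j z => [|m IHm] i j z /=; first by case: i j => [|i] [|j] //=; case: eqP.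
rewrite IHm; case: i j => [|i] [|j] //=.
- by rewrite linear0.
- by rewrite IHm eqSS; case: eqP.
Qed.

Lemma degpart_gt i m (z : ext m) : (m < i)%N -> degpart i z = 0.
Proof.
elim: m i z => [|m IHm] [|i] z //= mi.
by rewrite !IHm // ltnW.
Qed.

Lemma degpart_eq0 m (z : ext m) : (forall i, degpart i z = 0) -> z = 0.
Proof.
elim: m z => [|m IHm] z z0 /=; first by have := z0 0%N.
case: z z0 => u v z0; congr pair; apply: IHm => i.
  by have /= [] := z0 i.
by have /= [] := z0 i.+1.
Qed.

Lemma degpart_one i m : degpart i (ext_one m) = if i == 0 then ext_one m else 0.
Proof.
by elim: m i => [|m IHm] [|i] //=; rewrite IHm ?linear0.
Qed.

Lemma degpart_top i m : degpart i (ext_top m) = if i == m then ext_top m else 0.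
Proof.
elim: m i => [|m IHm] [|i] //=; first by rewrite linear0.
by rewrite linear0 IHm eqSS; case: eqP.
Qed.

Definition vec m (c : nat -> R) : ext m := wedge c (ext_one m).

Lemma degpart0P m (z : ext m) : exists r, degpart 0 z = r *: ext_one m.
Proof.
elim: m z => [|m IHm] z /=; first by exists z; rewrite [RHS]mulr1.
by have [r ->] := IHm z.1; exists r; congr pair => /=; rewrite scaler0.
Qed.

Lemma eq_wedge w w' m (z : ext m) :
  (forall k, (k < m)%N -> w k = w' k) -> wedge w z = wedge w' z.
Proof.
elim: m z => [|m IHm] z //= ww; rewrite ww //.
by rewrite !IHm // => k km; apply/ww/ltnW.
Qed.

Lemma vecS m c : vec m.+1 c = (vec m c, c m *: ext_one m).
Proof. by rewrite /vec /= linear0 subr0. Qed.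

Lemma degpart1P m (z : ext m) : exists c, degpart 1 z = vec m c.
Proof.
elim: m z => [|m IHm] z /=; first by exists (fun=> 0).
have [c ->] := IHm z.1; have [r ->] := degpart0P z.2.
exists (fun k => if k == m then r else c k); rewrite vecS eqxx.
congr pair; apply: eq_wedge => k km /=.
by case: eqP km => // ->; rewrite ltnn.
Qed.

Lemma degpart_vec i m c : degpart i (vec m c) = if i == 1 then vec m c else 0.
Proof.
case: i => [|i]; first by rewrite degpart0_wedge.
by rewrite /vec degpart_wedge degpart_one; case: i => //= i; rewrite linear0.
Qed.

Lemma vecZD m a c d : vec m (fun k => a * c k + d k) = a *: vec m c + vec m d.
Proof.
elim: m => [|m IHm]; first by rewrite /vec /= scaler0 addr0.
rewrite !vecS IHm; congr pair => /=; by rewrite scalerDl scalerA.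
Qed.

Lemma vecZ m a c : vec m (fun k => a * c k) = a *: vec m c.
Proof.
elim: m => [|m IHm]; first by rewrite /vec /= scaler0.
by rewrite !vecS IHm -scalerA.
Qed.

Lemma contract_one f m : contract f (ext_one m) = 0.
Proof. by have := contract_degpart0 f (ext_one m); rewrite degpart_one. Qed.

Lemma contract_vec f m c :
  contract f (vec m c) = (\sum_(k < m) c k * f k) *: ext_one m.
Proof. by rewrite -contract_wedge contract_one linear0 addr0. Qed.

Lemma ext_one_inj m (r s : R) : r *: ext_one m = s *: ext_one m -> r = s.
Proof.
by elim: m => [|m IHm] /=; [rewrite ![_ *: _]mulr1 | case=> /IHm].
Qed.

Lemma vec_inj m c d : vec m c = vec m d -> forall k, (k < m)%N -> c k = d k.
Proof.
elim: m => [|m IHm] //; rewrite !vecS => -[/IHm cd] /ext_one_inj cdm k.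
by rewrite ltnS leq_eqVlt => /predU1P[->|/cd].
Qed.

Lemma yspan_one y m j (r : R) : yspan y j (r *: ext_one m) -> @yspan R y R^o j r.
Proof.
elim: m => [|m IHm] /=; first by rewrite [_ *: _]mulr1.
by move=> /(yspan_pair y j (r *: ext_one m) _).1[/IHm].
Qed.

Lemma yspan_top y m j (r : R) : yspan y j (r *: ext_top m) -> @yspan R y R^o j r.
Proof.
elim: m => [|m IHm] /=; first by rewrite [_ *: _]mulr1.
by move=> /(yspan_pair y j _ (r *: ext_top m)).1[_ /IHm].
Qed.

Lemma yspan_contract y j f m (z : ext m) :
  (forall k, (k < m)%N -> @yspan R y R^o j (f k)) -> yspan y j (contract f z).
Proof.
elim: m z => [|m IHm] z fY /=; first exact: yspan0.
have IH (x : ext m) : yspan y j (contract f x) by apply: IHm => k km; apply/fY/ltnW.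
apply/yspan_pair; split; last by apply: yspanN.
by apply: yspanD => //; apply/yspan_scale/fY.
Qed.
End Exterior.

(** * Vanishing, duality and cyclicity of Koszul homology *)

Section Koszul.
Variable R : comNzRingType.
Implicit Types (y F a : nat -> R).

Definition genby F m (r : R) := exists v : nat -> R, r = \sum_(k < m) v k * F k.

Lemma genbyZD F m c u v :
  genby F m u -> genby F m v -> genby F m (c * u + v).
Proof.
move=> [w ->] [w' ->]; exists (fun l => c * w l + w' l).
by rewrite mulr_sumr -big_split; apply: eq_bigr => l _ /=; rewrite mulrDl mulrA.
Qed.

Lemma genby0 F m : genby F m 0.
Proof. by exists (fun=> 0); rewrite big1 // => l _; rewrite mul0r. Qed.

Lemma genbyZ F m c u :
  genby F m u -> genby F m (c * u).
Proof. by move=> Fu; rewrite -[_ * _]addr0; apply/genbyZD/genby0. Qed.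

Lemma genby_gen F m l : (l < m)%N -> genby F m (F l).
Proof.
move=> lm; exists (fun j => (j == l)%:R); rewrite (bigD1 (Ordinal lm)) //= eqxx mul1r.
rewrite big1 ?addr0 // => j jl.
by rewrite -[j == l :> nat]/(j == Ordinal lm) (negPf jl) mul0r.
Qed.

Lemma yspan_wedge y j a m (z : ext R m) :
  (forall k, (k < m)%N -> @yspan R y R^o j (a k)) -> yspan y j (wedge a z).
Proof.
elim: m z => [|m IHm] z aY /=; first exact: yspan0.
have IH (x : ext R m) : yspan y j (wedge a x) by apply: IHm => k km; apply/aY/ltnW.
apply/yspan_pair; split=> //; apply: yspanB => //.
exact/yspan_scale/aY.
Qed.

Lemma regular_ext y n m : regular y n R^o -> regular y n (ext R m).
Proof.
move=> yreg; elim: m => [|m IHm] //= j [u v] jn.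
by move=> /yspan_pair[/= /IHm uY /IHm vY]; apply/yspan_pair; split; [apply: uY|apply: vY].
Qed.

Section Vanishing.
Variables (y F : nat -> R) (n m : nat).
Hypothesis y_regular : regular y n R^o.
Hypothesis yF : forall j, (j < n)%N -> genby F m (y j).

(* Depth sensitivity: [y_0, .., y_{j-1}] being killed in homology, passing to the
   quotient by [y_j] shifts the range of vanishing by one. *)
Lemma koszul_vanish j i (z : ext R m) : (j <= n)%N -> (m + j < n + i)%N ->
  degpart i z = z -> yspan y j (contract F z) ->
  exists w, yspan y j (z - contract F w).
Proof.
(* Descending induction on j = n - e: at j = n the hypothesis forces i > m, where the exterior
   algebra is zero. *)
move=> jn; rewrite -(subKn jn); move: (n - j)%N (leq_subr j n) => e {j jn}.
elim: e i z => [|e IHe] i z en mi zi dz.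
  by exists 0; rewrite linear0 subr0 -zi degpart_gt; [exact: yspan0 | lia].
set j := (n - e.+1)%N in mi dz *; have jn : (j < n)%N by rewrite /j; lia.
have [v yE] := yF jn; have := contract_wedge F v z; rewrite -yE => hz.
have jS : (n - e)%N = j.+1 by rewrite /j; lia.
have hdY : yspan y j (wedge v (contract F z)) by exact: (yspan_linear (@wedge R v m)).
have [||||w] := IHe i.+1 (wedge v z); try lia.
- by rewrite degpart_wedge zi.
- rewrite jS /=; exists z; rewrite -hz opprD addrA subrr add0r; exact: yspanN.
(* The coefficient [x] of y_j is the primitive: the homotopy formula puts y_j (z - contract x) in
   the span, and regularity cancels y_j. *)
rewrite jS /= => -[x xY]; exists x.
have := yspan_linear (@contract R F m) xY.
rewrite 2!linearB linearZ /= contractK subr0 => xY'.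
apply: (regular_ext y_regular) jn _.
have -> : y j *: (z - contract F x) =
    contract F (wedge v z) - y j *: contract F x + wedge v (contract F z).
  by rewrite scalerBr -hz addrAC.
exact: yspanD.
Qed.
End Vanishing.

Section CyclicFirstHomology.
Variables (n m : nat) (x y F a : nat -> R).
Hypothesis m_def : m = n.+1.
Hypothesis y_regular : regular y n R^o.
Hypothesis yF : forall j, (j < n)%N -> genby F m (y j).
Hypothesis aF : \sum_(k < m) a k * F k = 0.
Hypothesis cyclic : forall c : nat -> R, \sum_(k < m) c k * F k = 0 ->
  exists r (w : ext R m), vec m c = r *: vec m a + contract F w.
(** Double colon property of linkage: for I = (F), the ideal (y) : ((y) : I) is contained in I. *)
Hypothesis dual : forall r, ~ genby F m r ->
  exists t, (forall k, (k < m)%N -> @yspan R y R^o n (t * F k)) /\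
    ~ @yspan R y R^o n (t * r).

(** The elements of (y) : (F) give the top-degree cycles modulo (y). *)
Lemma yspan_contract_top j t m' :
  (forall k, (k < m')%N -> @yspan R y R^o j (t * F k)) ->
  yspan y j (contract F (t *: ext_top R m')).
Proof.
elim: m' => [|m' IH] tF /=; first exact: yspan0.
apply/yspan_pair; split.
  rewrite scaler0 linear0 add0r scalerA; apply/yspan_scale; rewrite mulrC; exact: tF.
by apply: yspanN; apply: IH => k km; apply/tF/ltnW.
Qed.

(* The connecting homomorphisms identify the first homology of the Koszul complex
   with its top homology modulo [y_0, .., y_{n-1}]; this is the step from [j] to
   [j + 1]. *)
Lemma annihilator_shift r j (z : ext R m) :
  (exists w : ext R m, r *: vec m a = contract F w) -> (j <= n)%N ->
  degpart j.+1 z = z -> yspan y j (contract F z) ->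
  exists w, yspan y j (r *: z - contract F w).
Proof.
move=> [w0 rE]; elim: j z => [|j IHj] z jn zi /=.
  have [c] := degpart1P z; rewrite zi => ->; rewrite contract_vec => cF.
  have /cyclic[s [w ->]] : \sum_(k < m) c k * F k = 0.
    by apply: (@ext_one_inj _ m); rewrite scale0r.
  exists (s *: w0 + r *: w).
  rewrite contractD !contractZ -rE scalerDr !scalerA [s * r]mulrC.
  by rewrite subrr.
(* [u] represents the image of [z] under the connecting homomorphism; its projection to degree j + 1
   is fed to the induction hypothesis. *)
move=> [u uY]; have {}uY : yspan y j (contract F z - y j *: degpart j.+1 u).
  have := yspan_linear (@degpart R j.+1 m) uY.
  by rewrite linearB linearZ /= degpart_contract zi.
have [|||w wY] := IHj (degpart j.+1 u); first exact: ltnW.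
- by rewrite degpart_id eqxx.
- apply: (regular_ext y_regular) jn _.
  have := yspan_linear (@contract R F m) uY.
  rewrite linearB linearZ /= contractK sub0r => /yspanN.
  by rewrite opprK.
have wE := degpart_contract j.+1 F w.
have {}wY : yspan y j (r *: degpart j.+1 u - contract F (degpart j.+2 w)).
  have := yspan_linear (@degpart R j.+1 m) wY.
  by rewrite linearB linearZ /= degpart_id eqxx wE.
(* As m = n + 1, the vanishing range modulo y_0, .., y_{j-1} starts exactly at degree j + 2, where
   the corrected element lives. *)
have [||||v vY] := @koszul_vanish y F n m y_regular yF j j.+2
  (r *: z - y j *: degpart j.+2 w).
- exact: ltnW.
- by rewrite m_def; lia.
- by rewrite linearB !linearZ /= zi degpart_id eqxx.
- rewrite -scaleNr contractD !contractZ scaleNr.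
  have -> : r *: contract F z - y j *: contract F (degpart j.+2 w) =
      r *: (contract F z - y j *: degpart j.+1 u) +
      y j *: (r *: degpart j.+1 u - contract F (degpart j.+2 w)).
    by rewrite !scalerBr !scalerA [y j * r]mulrC addrA subrK.
  by apply: yspanD; apply: yspanZ.
by exists v, (degpart j.+2 w); rewrite addrAC.
Qed.

(** By the shift, [r] kills the top homology modulo (y), where there are no boundaries; so t r lies
    in (y) for every t in (y) : (F), and [dual] concludes. *)
Lemma annihilator_cyclic r (w : ext R m) :
  r *: vec m a = contract F w -> genby F m r.
Proof.
move=> rE; apply: contrapT => /dual[t [tF]]; apply.
have [||||v vY] := @annihilator_shift r n (t *: ext_top R m); first by exists w.
- by [].
- by rewrite linearZ /= degpart_top m_def eqxx.
- exact: yspan_contract_top.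
have := yspan_linear (@degpart R m m) vY.
rewrite linearB !linearZ /= degpart_top eqxx degpart_contract degpart_gt //.
rewrite linear0 subr0 scalerA mulrC; exact: yspan_top.
Qed.

Let D (z : ext R m) := contract F z + wedge a z.

Fact D_linear : linear D.
Proof.
by move=> r u v; rewrite /D !linearP /= scalerDr addrACA.
Qed.
HB.instance Definition _ := GRing.isLinear.Build R (ext R m) (ext R m) _ D D_linear.

Lemma tate_square z : D (D z) = 0.
Proof.
rewrite /D !linearD /= contractK wedgeK add0r addr0 addrC.
by rewrite addrC contract_wedge aF scale0r.
Qed.

(** The primitive is built by increasing degree: each step cancels the lowest component of the error
    z - D w by some [D v] with nothing in lower degrees. *)
Lemma tate_exact z : D z = 0 -> exists w, z = D w.
Proof.
move=> Dz.
suff H i : exists w, forall k, (k < i)%N -> degpart k (z - D w) = 0.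
  have [w wE] := H m.+1; exists w; apply/eqP; rewrite -subr_eq0; apply/eqP.
  apply: degpart_eq0 => k; case: (leqP k m) => [km|mk]; first exact: wE.
  exact: degpart_gt.
elim: i => [|i [w wE]]; first by exists 0.
suff [v vlt vE] : exists2 v, forall k, (k < i)%N -> degpart k (D v) = 0
    & degpart i (z - D w) = degpart i (D v).
  exists (w + v) => k; rewrite (linearD D) opprD addrA linearB ltnS leq_eqVlt.
  by move=> /predU1P[->|ki] /=; [rewrite vE subrr | rewrite wE // vlt // subr0].
have {Dz} : D (z - D w) = 0 by rewrite linearB /= Dz tate_square subrr.
move: (z - D w) wE => {w}z zlt Dz.
case: i zlt => [|[|i]] zlt.
- have [r rE] := degpart0P z.
  have /annihilator_cyclic[v vE] : r *: vec m a = contract F (- degpart 2 z).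
    have := congr1 (@degpart R 1 m) Dz; rewrite linear0 linearD /=.
    rewrite degpart_contract degpart_wedge rE linearZ /= => /eqP.
    by rewrite addrC addr_eq0 -linearN => /eqP.
  exists (vec m v) => //.
  by rewrite rE linearD /= degpart0_wedge addr0 contract_vec -vE linearZ /= degpart_one.
- have [c cE] := degpart1P z.
  have /cyclic[r [w wE]] : \sum_(k < m) c k * F k = 0.
    apply: (@ext_one_inj _ m); rewrite -contract_vec -cE -degpart_contract scale0r.
    have := congr1 (@degpart R 0 m) Dz.
    by rewrite linear0 linearD /= degpart0_wedge addr0.
  (* The degree 0 part produces r a through [wedge], the degree 2 part produces the boundary through
     [contract]. *)
  exists (r *: ext_one R m + degpart 2 w) => [[] // _|].
    rewrite linearD /= degpart0_wedge addr0 linearD linearZ /= contract_one scaler0 add0r.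
    by rewrite -degpart_contract degpart_id.
  have dpart k : degpart k (r *: ext_one R m + degpart 2 w) =
      r *: (if k == 0 then ext_one R m else 0) + if k == 2 then degpart 2 w else 0.
    by rewrite linearD linearZ /= degpart_one degpart_id.
  rewrite linearD /= degpart_contract degpart_wedge !dpart /= scaler0 add0r addr0.
  rewrite wedgeZ -degpart_contract -/(vec m a) cE addrC.
  have := congr1 (@degpart R 1 m) wE.
  by rewrite linearD linearZ /= !degpart_vec.
- have dz : contract F (degpart i.+2 z) = 0.
    have := congr1 (@degpart R i.+1 m) Dz; rewrite linear0 linearD /=.
    by rewrite degpart_contract degpart_wedge (zlt i) ?linear0 ?addr0 //.
  have [||||v vE] := @koszul_vanish y F n m y_regular yF 0 i.+2 (degpart i.+2 z).
  - by [].
  - by rewrite m_def; lia.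
  - by rewrite degpart_id eqxx.
  - by [].
  (* [D] sends degree i + 3 to degrees i + 2 and i + 4, so nothing lower is disturbed. *)
  exists (degpart i.+3 v) => [k ki|].
    rewrite linearD /= -degpart_contract degpart_id.
    rewrite ltn_eqF // add0r; case: k ki => [|k] ki; first by rewrite degpart0_wedge.
    have /negPf ki3 : k != i.+3 by lia.
    by rewrite degpart_wedge degpart_id ki3 linear0.
  rewrite linearD /= -degpart_contract degpart_id eqxx degpart_wedge degpart_id.
  have /negPf -> : i.+1 != i.+3 by lia.
  rewrite linear0 addr0.
  have := congr1 (@degpart R i.+2 m) (vE : _ = 0).
  rewrite linearB linear0 /= degpart_id eqxx degpart_contract => /eqP.
  by rewrite subr_eq0 => /eqP.
Qed.

Hypothesis x_regular : regular x n R^o.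

(* An exact differential stays exact modulo a nonzerodivisor; modulo all of
   [x_0, .., x_{n-1}] it vanishes, which is absurd. *)
Lemma tate_exact_mod j z : (j <= n)%N -> yspan x j (D z) ->
  exists w, yspan x j (z - D w).
Proof.
elim: j z => [|j IHj] z jn /=.
  by move=> /tate_exact[w ->]; exists w; rewrite subrr.
(* If D z is x_j c modulo the earlier elements, applying [D] and cancelling x_j makes c a cycle,
   hence some D w; then z - x_j w is a cycle modulo the earlier elements. *)
move=> [c cY]; have := yspan_linear D cY.
rewrite linearB linearZ /= tate_square sub0r => /yspanN; rewrite opprK.
move=> /(regular_ext x_regular jn) /(IHj _ (ltnW jn))[w wY].
have [|v vY] := IHj (z - x j *: w) (ltnW jn); last first.
  by exists v, w; rewrite addrAC.
rewrite linearB linearZ /=.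
have -> : D z - x j *: D w = D z - x j *: c + x j *: (c - D w).
  by rewrite scalerBr addrA subrK.
by apply: yspanD => //; apply: yspanZ.
Qed.

Lemma no_cyclic_first_homology :
    (forall k, (k < m)%N -> @yspan R x R^o n (F k)) ->
    (forall k, (k < m)%N -> @yspan R x R^o n (a k)) ->
  @yspan R x R^o n 1.
Proof.
move=> Fx ax.
have Dx z : yspan x n (D z) by apply: yspanD; [exact: yspan_contract|exact: yspan_wedge].
have [w wY] := tate_exact_mod (leqnn n) (Dx (ext_one R m)).
apply: (@yspan_one _ _ m); rewrite scale1r -[ext_one R m](subrK (D w)).
exact: yspanD.
Qed.
End CyclicFirstHomology.
End Koszul.

(** * Degree 1 Koszul boundaries in coordinates *)

Section KoszulBoundary.
Variables (R : comNzRingType) (F : nat -> R) (m : nat).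

Definition boundary (c : nat -> R) := exists w : ext R m, vec m c = contract F w.

Lemma boundaryZD a c d :
  boundary c -> boundary d -> boundary (fun k => a * c k + d k).
Proof.
move=> [w cw] [v dv]; exists (a *: w + v).
by rewrite vecZD cw dv contractD contractZ.
Qed.

Lemma eq_boundary c d :
  (forall k, (k < m)%N -> c k = d k) -> boundary c -> boundary d.
Proof. by move=> cd [w cw]; exists w; rewrite -cw; apply/esym/eq_wedge. Qed.

Lemma boundary0 : boundary (fun=> 0).
Proof.
exists 0; rewrite linear0; have := vecZD m (-1) (fun=> 0) (fun=> 0 : R).
rewrite scaleN1r addNr => <-; apply: eq_wedge => k _; by rewrite mulr0 addr0.
Qed.

Lemma boundary_pair i j : (i < m)%N -> (j < m)%N ->
  boundary (fun k => F i * (k == j)%:R - F j * (k == i)%:R).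
Proof.
move=> im jm; exists (wedge (fun k => (k == i)%:R) (vec m (fun k => (k == j)%:R))).
have sum_delta l : (l < m)%N -> \sum_(k < m) (k == l :> nat)%:R * F k = F l.
  move=> lm; rewrite (bigD1 (Ordinal lm)) //= eqxx mul1r big1 ?addr0 // => k kl.
  by rewrite -[k == l :> nat]/(k == Ordinal lm) (negPf kl) mul0r.
have := contract_wedge F (fun k => (k == i)%:R) (vec m (fun k => (k == j)%:R)).
rewrite contract_vec !sum_delta // wedgeZ => hz.
rewrite -[RHS](addrK (F j *: vec m (fun k => (k == i)%:R))) [X in X - _]hz.
rewrite -scaleNr -(vecZ _ (- F j)) -vecZD; apply: eq_wedge => k _.
by rewrite mulNr.
Qed.

End KoszulBoundary.

(** A degree 2 element amounts to an alternating matrix; writing it as [c] minus its transpose gives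
    a zero diagonal in every characteristic. *)
Lemma boundary_antisym (R : comNzRingType) (F : nat -> R) m (w : ext R m) :
  exists c : nat -> nat -> R, degpart 1 (contract F w) =
    vec m (fun i => \sum_(j < m) (c i j - c j i) * F j).
Proof.
elim: m w => [|m IHm] w; first by exists (fun _ _ => 0).
have [c cE] := IHm w.1; have [b bE] := degpart1P w.2.
exists (fun i j => if i == m then 0 else if j == m then b i else c i j).
rewrite vecS [LHS]/= linearD linearZ /= linearN /= cE bE; congr pair.
  rewrite addrC -vecZD; apply: eq_wedge => i im.
  rewrite big_ord_recr /= eqxx ltn_eqF // subr0 addrC [F m * _]mulrC; congr (_ + _).
  by apply: eq_bigr => j _; rewrite !ltn_eqF.
rewrite degpart_contract bE contract_vec big_ord_recr /= eqxx subrr mul0r addr0.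
rewrite -scaleNr -sumrN; congr (_ *: _); apply: eq_bigr => j _.
by rewrite ltn_eqF // sub0r mulNr.
Qed.

(** * Powers of the variables *)

(** The Koszul complex takes families on [nat]; the default value also fills index [n], the later
    place of [f]. *)
Definition ordfam (T : Type) n (g : 'I_n -> T) (d : T) (i : nat) := oapp g d (insub i).

Lemma ordfamE (T : Type) n (g : 'I_n -> T) d (i : 'I_n) : ordfam g d i = g i.
Proof. by rewrite /ordfam valK. Qed.

Lemma ordfam_ge (T : Type) n (g : 'I_n -> T) d i : (n <= i)%N -> ordfam g d i = d.
Proof. by move=> ni; rewrite /ordfam insubF // ltnNge ni. Qed.

(** A matrix of maximal rank with rows in [U] has row space [U], since a further row of [U] cannot
    raise the rank; a column of its cokernel matrix detects [v]. *)
Lemma separating_functional (k : fieldType) d (U : 'rV[k]_d -> Prop) (v : 'rV[k]_d) :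
  U 0 -> (forall a u w, U u -> U w -> U (a *: u + w)) -> ~ U v ->
  exists2 phi : 'cV[k]_d, forall u, U u -> u *m phi = 0 & v *m phi != 0.
Proof.
move=> U0 UZD NUv.
have Umx m (W : 'M[k]_(m, d)) u : (forall i, U (row i W)) -> (u <= W)%MS -> U u.
  move=> UW /submxP[D ->]; rewrite mulmx_sum_row.
  by apply: big_rec => // i w _; apply: UZD.
pose P r := `[< exists2 W : 'M[k]_d, forall i, U (row i W) & \rank W = r >].
have P0 : exists r, P r.
  by exists 0%N; apply/asboolP; exists 0 => [i|]; rewrite ?row0 ?mxrank0.
have Pd r : P r -> (r <= d)%N by move=> /asboolP[W _ <-]; apply: rank_leq_row.
case: (ex_maxnP P0 Pd) => r /asboolP[W UW Wr] rmax.
have UsubW u : U u -> (u <= W)%MS.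
  move=> Uu; have Urow i : U (row i (W + u)%MS).
    apply: (Umx _ (col_mx W u)); last by rewrite -addsmxE row_sub.
    by move=> l; case: (split_ordP l) => e ->; rewrite ?rowKu ?rowKd ?row_id.
  have := rmax (\rank (W + u)%MS); rewrite -Wr => le_rank.
  have {}le_rank : (\rank (W + u)%MS <= \rank W)%N.
    by apply: le_rank; apply/asboolP; exists (W + u)%MS.
  apply: submx_trans (addsmxSr W u) _.
  by rewrite -(geq_leqif (mxrank_leqif_sup (addsmxSl W u))).
have : v *m cokermx W != 0.
  by rewrite -submxE; apply/negP => /(Umx _ _ _ UW).
move=> /matrix0Pn[i [j vW]]; exists (col j (cokermx W)) => [u /UsubW|].
  by rewrite submxE => /eqP uW; rewrite colE mulmxA uW mul0mx.
apply/matrix0Pn; exists i, 0; by rewrite colE mulmxA -colE mxE.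
Qed.

Section MonomialPowers.
Variables (k : fieldType) (n N : nat).
Local Notation S := {mpoly k[n]}.

Definition xpow : nat -> S := ordfam (fun i => 'X_i ^+ N) 0.

Definition divby_xpow j (m : 'X_{1..n}) := [exists i : 'I_n, (i < j)%N && (N <= m i)%N].

Lemma divby_xpow_le j (m m' : 'X_{1..n}) :
  (m <= m')%MM -> divby_xpow j m -> divby_xpow j m'.
Proof.
move=> /mnm_lepP mm' /existsP[i /andP[ij Ni]]; apply/existsP; exists i.
by rewrite ij (leq_trans Ni).
Qed.

Lemma xpowE (i : 'I_n) : xpow i = 'X_[U_(i) *+ N].
Proof. by rewrite /xpow ordfamE mpolyXn. Qed.

Lemma pow_mnm_le (i : 'I_n) (m : 'X_{1..n}) : (U_(i) *+ N <= m)%MM = (N <= m i)%N.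
Proof.
apply/mnm_lepP/idP => [/(_ i)|Ni l]; rewrite mulmnE mnm1E; first by rewrite eqxx mul1n.
by case: eqP => [<-|_]; [rewrite mul1n | rewrite mul0n].
Qed.

Lemma mcoeffXM_le (m m' : 'X_{1..n}) (q : S) :
  (m <= m')%MM -> ('X_[m] * q)@_m' = q@_(m' - m).
Proof. by move=> mm'; rewrite -{1}(submK mm') mulrC addmC mcoeffMX. Qed.

Lemma mem_msuppXM (m m' : 'X_{1..n}) (q : S) :
  m' \in msupp ('X_[m] * q) -> (m <= m')%MM.
Proof.
by rewrite mulrC (perm_mem (msuppMX q m)) => /mapP[m1 _ ->]; rewrite lem_addr.
Qed.

Lemma yspan_xpow j (q : S) : (j <= n)%N ->
  @yspan S xpow S^o j q <-> (forall m, m \in msupp q -> divby_xpow j m).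
Proof.
move=> jn; split=> [|qj].
  elim: j q jn => [|j IHj] q jn /=; first by move=> ->; rewrite msupp0.
  move=> [c /(IHj _ (ltnW jn)) cj] m.
  have -> : q = q - xpow j *: (c : S^o) + xpow j * c by rewrite subrK.
  move=> /msuppD_le; rewrite mem_cat => /orP[/cj|].
    by move=> /existsP[i /andP[ij Ni]]; apply/existsP; exists i; rewrite ltnW.
  rewrite -[j]/(val (Ordinal jn)) xpowE => /mem_msuppXM; rewrite pow_mnm_le => Nm.
  by apply/existsP; exists (Ordinal jn); rewrite /= ltnSn.
rewrite [q]mpolyE big_seq; apply: (@yspan_sum _ xpow S^o) => m /qj.
move=> /existsP[i /andP[ij Ni]]; rewrite -mul_mpolyC.
rewrite -pow_mnm_le in Ni; rewrite -(submK Ni) mpolyXD -xpowE mulrA mulrC.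
exact: (@yspan_gen _ xpow S^o).
Qed.

(** Multiplying a monomial by X_j^N leaves the exponents of the X_i with i < j unchanged, so it
    creates no divisibility by the earlier powers. *)
Lemma regular_xpow : regular xpow n (S^o : lmodType S).
Proof.
move=> j q jn /yspan_xpow H; apply/yspan_xpow => [|m mq]; first exact: ltnW.
have := H (ltnW jn) (U_(Ordinal jn) *+ N + m)%MM.
have -> : xpow j *: q = 'X_[U_(Ordinal jn) *+ N] * (q : S) by rewrite -xpowE.
rewrite mcoeff_msupp mcoeffXM_le ?lem_addr // [(_ *+ _ + m)%MM]addmC addmK -mcoeff_msupp.
move=> /(_ mq) /existsP[i /andP[ij Ni]]; apply/existsP; exists i; rewrite ij /=.
move: Ni; rewrite mnmDE mulmnE mnm1E.
by case: eqP ij => [<-|_] //=; [rewrite ltnn | rewrite mul0n addn0].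
Qed.

(** Induction on degree: in the coefficient of s q at a monomial m outside the ideal, the terms
    other than s(0) q_m involve proper divisors of m, also outside the ideal, where q already has no
    coefficient. *)
Lemma yspan_xpow_unit (s q : S) : s@_0 != 0 ->
  @yspan S xpow S^o n (s * q) -> @yspan S xpow S^o n q.
Proof.
move=> s0 /yspan_xpow sq; apply/yspan_xpow => // m.
have [d] := ubnP (mdeg m); elim: d m => // d IHd m.
rewrite ltnS => md mq; apply: contraT => mN.
suff : m \in msupp (s * q) by move=> /(sq (leqnn n)); rewrite (negPf mN).
rewrite mcoeff_msupp mcoeffM.
have m0 : (mdeg (0%MM : 'X_{1..n}) < (mdeg m).+1)%N by rewrite mdeg0.
have mm : (mdeg m < (mdeg m).+1)%N by [].
rewrite (bigD1 (BMultinom m0, BMultinom mm)) /= ?add0m //.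
rewrite big1 ?addr0 => [|[k1 k2] /= /andP[/eqP mE k12]].
  by rewrite mulf_neq0 // -mcoeff_msupp.
apply/eqP; rewrite mulf_eq0; apply/orP; right; apply: contraT.
rewrite -mcoeff_msupp => k2q.
suff k2d : (mdeg k2 < d)%N.
  have k2m : (k2 <= m)%MM by rewrite [X in (_ <= X)%MM]mE lem_addl.
  by have := divby_xpow_le k2m (IHd _ k2d k2q); rewrite (negPf mN).
apply: leq_trans md; rewrite [X in (_ < mdeg X)%N]mE mdegD -[X in (X < _)%N]add0n ltn_add2r lt0n mdeg_eq0.
apply: contraNneq k12 => k10; rewrite xpair_eqE.
have k2m : bmnm k2 = m by rewrite [RHS]mE k10 add0m.
by apply/andP; split; apply/eqP; apply: val_inj.
Qed.


Hypothesis N_gt0 : (0 < N)%N.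

(** The [mon al] represent a basis of the quotient by the X_i^N, and [top] spans its socle. *)
Let box := {ffun 'I_n -> 'I_N}.
Let mon (al : box) : 'X_{1..n} := [multinom (al i : nat) | i < n].
Let top : 'X_{1..n} := [multinom N.-1 | i < n].

Let mon_top al : (mon al <= top)%MM.
Proof. by apply/mnm_lepP => i; rewrite !mnmE -ltnS prednK. Qed.

Let top_ndiv m : (m <= top)%MM = ~~ divby_xpow n m.
Proof.
apply/mnm_lepP/idP => [mt|mN i].
  apply/existsPn => i; rewrite ltn_ord /= -ltnNge.
  by have := mt i; rewrite mnmE -ltnS prednK.
by move/existsPn: mN => /(_ i); rewrite ltn_ord /= -ltnNge mnmE; lia.
Qed.

Let ndiv_mon m : ~~ divby_xpow n m -> exists al, m = mon al.
Proof.
move=> mN; have mi i : (m i < N)%N.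
  by move/existsPn: mN => /(_ i); rewrite ltn_ord /= -ltnNge.
by exists [ffun i => Ordinal (mi i)]; apply/mnmP => i; rewrite mnmE ffunE.
Qed.

(* Macaulay duality for the monomial complete intersection: a functional [phi] on
   the quotient is [h |-> (t h)_top] with [t = \sum phi(X^al) X^(top - al)]. *)
Lemma xpow_dual (I : S -> Prop) (r : S) :
    I 0 -> (forall a b c, I b -> I c -> I (a * b + c)) ->
    (forall i : 'I_n, I (xpow i)) -> ~ I r ->
  exists t, (forall h, I h -> @yspan S xpow S^o n (t * h)) /\
    ~ @yspan S xpow S^o n (t * r).
Proof.
move=> I0 IMD Ix NIr.
have IM a b : I b -> I (a * b) by move=> Ib; rewrite -[_ * _]addr0; apply: IMD.
have ID b c : I b -> I c -> I (b + c) by move=> *; rewrite -[b]mul1r; apply: IMD.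
pose ext_of (v : 'rV[k]_#|box|) : S := \sum_e v 0 e *: 'X_[mon (enum_val e)].
pose cut (h : S) : 'rV[k]_#|box| := \row_e h@_(mon (enum_val e)).
have cutP h : I (h - ext_of (cut h)).
  have Iy q : @yspan S xpow S^o n q -> I q.
    move=> /yspan_xpow qY; rewrite [q]mpolyE.
    rewrite big_seq; elim/big_rec: _ => // m b /(qY (leqnn n)).
    move=> /existsP[i /andP[_ Ni]]; apply: ID.
    rewrite -pow_mnm_le in Ni.
    by rewrite -mul_mpolyC -(submK Ni) mpolyXD mulrA -xpowE; apply: IM.
  apply/Iy/yspan_xpow => // m; apply: contraTT => /ndiv_mon[al ->].
  rewrite mcoeff_msupp negbK mcoeffB /ext_of raddf_sum /=.
  rewrite (bigD1 (enum_rank al)) //= big1 => [|e eal].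
    by rewrite addr0 mcoeffZ mcoeffX mxE enum_rankK eqxx mulr1 subrr.
  rewrite mcoeffZ mcoeffX; case: eqP => [eq_mon|_]; last by rewrite mulr0.
  case/eqP: eal; apply: enum_val_inj; rewrite enum_rankK.
  apply/ffunP => i; apply: val_inj => /=.
  by have /mnmP/(_ i) := eq_mon; rewrite !mnmE.
have [|a u w Iu Iw|Ir|phi phi0 phir] :=
    @separating_functional k _ (fun v => I (ext_of v)) (cut r).
- by rewrite /ext_of big1 // => e _; rewrite mxE scale0r.
- suff -> : ext_of (a *: u + w) = a%:MP * ext_of u + ext_of w by apply: IMD.
  rewrite mul_mpolyC scaler_sumr -big_split; apply: eq_bigr => e _.
  by rewrite /= !mxE scalerDl scalerA.
- by apply: NIr; rewrite -[r](subrK (ext_of (cut r))); apply: ID.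
pose t : S := \sum_e phi e 0 *: 'X_[top - mon (enum_val e)].
have tE h : (t * h)@_top = (cut h *m phi) 0 0.
  rewrite mulr_suml raddf_sum mxE; apply: eq_bigr => e _ /=.
  rewrite -scalerAl mcoeffZ mcoeffXM_le ?lem_subr // mxE mulrC; congr (_@_ _ * _).
  by apply/mnmP => i; have /mnm_lepP/(_ i) := mon_top (enum_val e); rewrite !mnmBE => /subKn.
exists t; split=> [h Ih|/(yspan_xpow _ (leqnn n)).1 trY].
  apply/yspan_xpow => // m; apply: contraTT; rewrite -top_ndiv => mt.
  (* The coefficient of t h at m is that of t X^(top - m) h at [top], which is [phi] of an element
     of [I]. *)
  have := tE ('X_[top - m] * h); rewrite mulrCA mcoeffXM_le ?lem_subr //.
  have -> : (top - (top - m))%MM = m.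
    by apply/mnmP => i; have /mnm_lepP/(_ i) := mt; rewrite !mnmBE => /subKn.
  rewrite mcoeff_msupp negbK => ->; rewrite phi0 ?mxE //.
  have := cutP ('X_[top - m] * h); rewrite -[X in I X]/(_ + _) => Icut.
  rewrite -[ext_of _](subKr ('X_[top - m] * h)) -mulN1r addrC.
  by apply: IMD => //; apply: IM.
have := top_ndiv top; rewrite lepm_refl => /esym/negP; apply; apply: trY.
rewrite mcoeff_msupp tE; apply: contraNneq phir => ph0.
by apply/eqP/matrixP => i j; rewrite !ord1 [RHS]mxE.
Qed.

End MonomialPowers.

(** * The local ring at a rational point *)

Section LocalRing.
Variables (k : fieldType) (n : nat) (R : comNzRingType).
Local Notation S := {mpoly k[n]}.
Variable iota : {rmorphism S -> R}.
Hypothesis iota_inj : injective iota.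
Hypothesis iota_frac : forall r, exists s a, s@_0 != 0 /\ iota s * r = iota a.
Hypothesis iota_unit : forall s, s@_0 != 0 -> exists v, v * iota s = 1.

Definition loc_xpow N i : R := iota (xpow k n N i).

Variable N : nat.
Local Notation Y := (loc_xpow N).
Local Notation yspanR := (@yspan R Y R^o).
Local Notation yspanS := (@yspan S (xpow k n N) S^o).

Lemma yspan_iota j a : yspanS j a -> yspanR j (iota a).
Proof.
elim: j a => [|j IHj] a /=; first by move=> ->; rewrite rmorph0.
move=> [c /IHj ac]; exists (iota c); move: ac.
by rewrite [_ *: _]/(_ * _) rmorphB rmorphM.
Qed.

Lemma iota_cancel s (r : R) : s@_0 != 0 -> forall j, yspanR j (iota s * r) -> yspanR j r.
Proof.
move=> /iota_unit[v vs] j /(yspanZ v).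
by rewrite [_ *: _]mulrA vs mul1r.
Qed.

Lemma yspan_frac j r : yspanR j r ->
  exists s a, [/\ s@_0 != 0, iota s * r = iota a & yspanS j a].
Proof.
elim: j r => [|j IHj] r /=.
  move=> ->; exists 1, 0; split=> //; last by rewrite mulr0 rmorph0.
  by rewrite mcoeff1 eqxx oner_eq0.
move=> [c /IHj[s [a [s0 sr aY]]]]; have [s' [b [s'0 s'c]]] := iota_frac c.
exists (s * s'), (s' * a + xpow k n N j * (s * b)); split.
- by rewrite rmorphM mulf_neq0.
- have {}sr : iota s * (r - iota (xpow k n N j) * c) = iota a by exact: sr.
  by rewrite rmorphD !rmorphM /= -sr -s'c; ring.
- exists (s * b : S^o); rewrite addrK; exact: (yspanZ s').
Qed.

Lemma regular_loc_xpow : regular Y n (R^o : lmodType R).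
Proof.
move=> j r jn; have [s [a [s0 sr]]] := iota_frac r.
move=> /(yspanZ (iota s)); rewrite [_ *: (_ *: _)]mulrCA sr -rmorphM.
move=> /yspan_frac[s' [b [s'0 /=]]]; rewrite -rmorphM => /iota_inj <-.
rewrite mulrCA => /(regular_xpow jn)/yspan_iota.
by rewrite rmorphM /= => /(iota_cancel s'0); rewrite -sr => /(iota_cancel s0).
Qed.

(** The contraction of (F) to polynomials contains the X_i^N, so [xpow_dual] provides t there;
    factors with nonzero constant term can be cancelled modulo (X_i^N). *)
Lemma loc_xpow_dual (F : nat -> R) m r : (0 < N)%N ->
    (forall i, (i < n)%N -> genby F m (Y i)) -> ~ genby F m r ->
  exists t, (forall l, (l < m)%N -> yspanR n (t * F l)) /\ ~ yspanR n (t * r).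
Proof.
move=> N0 YF NFr; have [s [a [s0 sr]]] := iota_frac r.
have [||||t [tF ta]] := @xpow_dual k n N N0 (fun b => genby F m (iota b)) a.
- by rewrite rmorph0; apply: genby0.
- by move=> b c d Fc Fd; rewrite rmorphD rmorphM; apply: genbyZD.
- by move=> i; apply: YF.
- move=> Fa; apply: NFr; have [v vs] := iota_unit s0.
  by rewrite -[r]mul1r -vs -mulrA sr; apply: genbyZ.
exists (iota t); split=> [l lm|trY].
  have [s' [b [s'0 s'F]]] := iota_frac (F l).
  apply: (iota_cancel s'0); rewrite mulrCA s'F -rmorphM; apply/yspan_iota/tF.
  rewrite -s'F; exact/genbyZ/genby_gen.
apply: ta; have : yspanR n (iota (t * a)).
  by rewrite rmorphM /= -sr mulrCA; apply: (@yspanZ R Y R^o).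
move=> /yspan_frac[s' [b [s'0]]]; rewrite -rmorphM => /iota_inj <-.
exact: yspan_xpow_unit.
Qed.

End LocalRing.

(** * Localization at p as a translated localization at the origin *)

Section Point.
Variables (k : fieldType) (n : nat) (p : 'I_n -> k).
Local Notation S := {mpoly k[n]}.
Local Notation P := (point_ideal p).
Local Notation R := (locring P).

Definition loc (a : S) : R := @locfrac S P S^o a (denom1 P).

Lemma locfrac_eqP (a b : S) (s t : denom P) :
  @locfrac S P S^o a s = @locfrac S P S^o b t <-> den_val t * a = den_val s * b.
Proof.
split=> [/locfracP[u uE]|ab]; last by apply/locfracP; exists (denom1 P); congr (_ *: _).
suff u0 : den_val u != 0 by apply: (mulfI u0).
by apply: contraNneq (denP u) => ->; rewrite rpred0.
Qed.

Fact loc_is_zmod_morphism : zmod_morphism loc.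
Proof.
move=> a b; apply/eqP; rewrite eq_sym subr_eq eq_sym; apply/eqP.
rewrite [LHS]locfracD; apply/locfrac_eqP => /=.
by rewrite ![_ *: _]mul1r !mul1r subrK.
Qed.
Fact loc_is_monoid_morphism : monoid_morphism loc.
Proof.
split=> // a b; rewrite [RHS]loc_mulE; apply/locfrac_eqP => /=.
by rewrite !mul1r.
Qed.
HB.instance Definition _ := GRing.isZmodMorphism.Build S R loc loc_is_zmod_morphism.
HB.instance Definition _ := GRing.isMonoidMorphism.Build S R loc loc_is_monoid_morphism.

Lemma loc_inj : injective loc.
Proof. by move=> a b /locfrac_eqP; rewrite !mul1r. Qed.

Lemma locE (a : S) (s : denom P) : loc (den_val s) * @locfrac S P S^o a s = loc a.
Proof. by rewrite [LHS]loc_mulE; apply/locfrac_eqP; rewrite /= !mul1r. Qed.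

Lemma loc_frac (r : R) : exists s a, s.@[p] != 0 /\ loc s * r = loc a.
Proof.
have [[a s] ->] := locfracE r; exists (den_val s), a; rewrite locE; split=> //.
by have := denP s; rewrite mem_point_ideal.
Qed.

Lemma loc_unit (s : S) : s.@[p] != 0 -> exists v, v * loc s = 1.
Proof.
move=> s0; have sP : s \notin (P : {pred S}) by rewrite mem_point_ideal.
by exists (@locfrac S P S^o 1 (Denom sP)); rewrite mulrC (locE _ (Denom sP)) rmorph1.
Qed.

Definition shift (c : 'I_n -> k) : {rmorphism S -> S} :=
  comp_mpoly [tuple 'X_i + (c i)%:MP | i < n].

Lemma shiftX c i : shift c 'X_i = 'X_i + (c i)%:MP.
Proof. by rewrite /shift /= comp_mpolyXU -tnth_nth tnth_mktuple. Qed.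

Lemma shiftC c (d : k) : shift c d%:MP = d%:MP.
Proof. exact: comp_mpolyC. Qed.

Lemma shiftK c d : (forall i, c i + d i = 0) -> cancel (shift c) (shift d).
Proof.
move=> cd; elim/mpoly_alg_ind => [e|i|a b aE bE|a b aE bE].
- by rewrite !shiftC.
- by rewrite shiftX rmorphD /= shiftX shiftC -addrA -mpolyCD addrC [d i + _]addrC cd add0r.
- by rewrite !rmorphD /= aE bE.
- by rewrite !rmorphM /= aE bE.
Qed.

Lemma meval_shift c a v : (shift c a).@[v] = a.@[fun i => v i + c i].
Proof.
elim/mpoly_alg_ind: a => [e|i|a b aE bE|a b aE bE].
- by rewrite shiftC !mevalC.
- by rewrite shiftX mevalD !mevalXU mevalC.
- by rewrite rmorphD /= !mevalD aE bE.
- by rewrite rmorphM /= !mevalM aE bE.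
Qed.

Lemma mcoeff0_meval (a : S) v : (forall i, v i = 0) -> a@_0 = a.@[v].
Proof.
move=> v0; elim/mpoly_alg_ind: a => [e|i|a b aE bE|a b aE bE].
- by rewrite mcoeffC eqxx mulr1 mevalC.
- by rewrite mevalXU v0 mcoeffX mnm1_eq0.
- by rewrite mcoeffD mevalD aE bE.
- by rewrite mevalM -aE -bE rmorphM.
Qed.

(** Sending X_i to X_i - p_i moves the origin to p, so this map has the properties required of
    [iota]. *)
Definition loc_shift : {rmorphism S -> R} := loc \o shift (fun i => - p i).

Lemma shiftpK : cancel (shift (fun i => - p i)) (shift p).
Proof. by apply: shiftK => i; rewrite addNr. Qed.
Lemma shiftKp : cancel (shift p) (shift (fun i => - p i)).
Proof. by apply: shiftK => i; rewrite addrN. Qed.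

Lemma loc_shift_inj : injective loc_shift.
Proof. by move=> a b /loc_inj /(can_inj shiftpK). Qed.

Lemma loc_shift_frac r : exists s a, s@_0 != 0 /\ loc_shift s * r = loc_shift a.
Proof.
have [s [a [s0 sr]]] := loc_frac r; exists (shift p s), (shift p a).
rewrite /= !shiftKp; split=> //.
rewrite (@mcoeff0_meval _ (fun=> 0)) // meval_shift.
by rewrite (@meval_eq _ _ _ p) // => i; rewrite add0r.
Qed.

Lemma loc_shift_unit s : s@_0 != 0 -> exists v, v * loc_shift s = 1.
Proof.
move=> s0; apply: loc_unit; rewrite meval_shift -mcoeff0_meval // => i.
by rewrite subrr.
Qed.

Lemma loc_shift_xpow N (i : 'I_n) : loc_xpow loc_shift N i = loc ('X_i - (p i)%:MP) ^+ N.
Proof. by rewrite /loc_xpow /xpow ordfamE rmorphXn /= shiftX mpolyCN. Qed.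

End Point.

(** * Quasi-regularity and algebraic dependence *)

Section QuasiRegular.
Variables (R : comNzRingType) (m : nat) (f : 'I_m -> R).

Hypothesis koszul_acyclic1 : forall c : 'I_m -> R, \sum_i c i * f i = 0 ->
  exists t : 'I_m -> 'I_m -> R, forall i, c i = \sum_j (t i j - t j i) * f j.
Hypothesis natr_unit : forall d, (0 < d)%N -> exists v : R, v * d%:R = 1.

(** The hypothesis is applied to the coefficients at each monomial; the degree bound [K] makes the
    chosen families polynomials. *)
Lemma koszul_acyclic1_mpoly l (g : 'I_m -> {mpoly R[l]}) :
  \sum_i f i *: g i = 0 ->
  exists t : 'I_m -> 'I_m -> {mpoly R[l]},
    forall i, g i = \sum_j f j *: (t i j - t j i).
Proof.
move=> gf.
have coefs (mu : 'X_{1..l}) : exists t : 'I_m -> 'I_m -> R,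
    forall i, (g i)@_mu = \sum_j (t i j - t j i) * f j.
  apply: koszul_acyclic1; have := congr1 (mcoeff mu) gf.
  rewrite mcoeff0 raddf_sum /= => gf0; rewrite -[RHS]gf0; apply: eq_bigr => i _.
  by rewrite mcoeffZ mulrC.
have [t tE] := choice coefs.
pose K := \max_i msize (g i).
exists (fun i j => \sum_(mu : 'X_{1..l < K}) t mu i j *: 'X_[mu]) => i.
rewrite [g i](@mpolywE _ _ K) ?leq_bigmax //.
under eq_bigr do rewrite tE scaler_suml.
rewrite exchange_big; apply: eq_bigr => j _ /=.
rewrite -sumrB scaler_sumr; apply: eq_bigr => mu _.
by rewrite -scalerBl scalerA mulrC.
Qed.

Lemma euler_homog d (F : {mpoly R[m]}) : F \is d.-homog ->
  \sum_i 'X_i * F^`M(i) = d%:R *: F.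
Proof.
move=> /dhomogP Fd; rewrite [F in RHS]mpolyE scaler_sumr.
under eq_bigr => i _.
  rewrite {1}[F]mpolyE raddf_sum mulr_sumr /=.
  under eq_bigr => mu _ do rewrite mderivZ mderivX.
  over.
rewrite exchange_big big_seq [RHS]big_seq; apply: eq_bigr => mu /Fd muF /=.
have <- : mdeg mu = d by exact: muF.
rewrite mdegE natr_sum scaler_suml; apply: eq_bigr => i _.
rewrite -!scalerAr !scalerA [in RHS]mulrC; have [->|mu0] := posnP (mu i).
  by rewrite mulr0 !scale0r.
rewrite -mpolyXD addmC submK //; apply/mnm_lepP => l.
by rewrite mnm1E; case: eqP => [<-|].
Qed.

(* Quasi-regularity only needs exactness of the Koszul complex in degree 1: by
   induction on [d], a relation [F(f) = 0] yields [F = \sum f_i w_i] with the extra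
   information [\sum X_i w_i = 0], which is what makes the induction go through
   after differentiating and applying Euler's formula. *)
Lemma koszul_quasi_regular d (F : {mpoly R[m]}) : F \is d.-homog -> F.@[f] = 0 ->
  exists2 w : 'I_m -> {mpoly R[m]}, \sum_i 'X_i * w i = 0 & F = \sum_i f i *: w i.
Proof.
elim: d F => [|d IHd] F Fd Ff.
  suff F0 : F = 0.
    by exists (fun=> 0); rewrite ?F0 big1 // => i _; rewrite ?mulr0 ?scaler0.
  have FC : F = (F@_0)%:MP.
    apply/mpolyP => mu; rewrite mcoeffC; case: eqP => [->|/eqP mu0].
      by rewrite mulr1.
    have nd : mdeg mu != 0%N by rewrite mdeg_eq0.
    by rewrite mulr0 (dhomog_nemf_coeff Fd nd).
  by move: Ff; rewrite FC mevalC => ->.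
have dF i : F^`M(i) \is d.-homog.
  apply/dhomogP => mu; rewrite mcoeff_msupp mcoeff_deriv => dF0.
  apply/eqP; rewrite -eqSS; apply: contraNT dF0 => mud.
  have nd : mdeg (mu + U_(i)) != d.+1 by rewrite mdegD mdeg1 addn1.
  by rewrite (dhomog_nemf_coeff Fd nd) mul0rn.
pose G := \sum_i f i *: F^`M(i).
have Gd : G \is d.-homog by apply: rpred_sum => i _; apply: rpredZ.
have Gf : G.@[f] = 0.
  have := congr1 (meval f) (euler_homog Fd).
  rewrite mevalZ Ff mulr0 raddf_sum => <-; rewrite raddf_sum; apply: eq_bigr => i _ /=.
  by rewrite mevalZ mevalM mevalXU.
have [w Xw Gw] := IHd G Gd Gf.
have [|t tE] := @koszul_acyclic1_mpoly m (fun i => F^`M(i) - w i).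
  by under eq_bigr do rewrite scalerBr; rewrite sumrB -Gw subrr.
have [v vd] := natr_unit (ltn0Sn d).
(* Antisymmetry gives the relation with the X_j; Euler's formula, with [v] inverse to d + 1,
   recovers F because \sum X_i w_i = 0. *)
exists (fun j => v *: \sum_i 'X_i * (t i j - t j i)).
  under eq_bigr do rewrite -scalerAr mulr_sumr.
  rewrite -scaler_sumr.
  under eq_bigr do under eq_bigr do rewrite !mulrBr.
  under eq_bigr do rewrite sumrB; rewrite sumrB exchange_big /=.
  by rewrite [X in X - _](eq_bigr _ (fun i _ => eq_bigr _ (fun j _ => mulrCA _ _ _))) subrr scaler0.
have -> : F = v *: \sum_i 'X_i * (F^`M(i) - w i).
  under eq_bigr do rewrite mulrBr; rewrite sumrB Xw subr0 (euler_homog Fd).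
  by rewrite scalerA vd scale1r.
rewrite scaler_sumr; under eq_bigr do rewrite tE mulr_sumr scaler_sumr.
rewrite exchange_big; apply: eq_bigr => j _ /=.
rewrite !scaler_sumr; apply: eq_bigr => i _.
by rewrite -scalerAr !scalerA mulrC.
Qed.
End QuasiRegular.

(** * Algebraic dependence of more than n polynomials in n variables *)

Section AlgebraicDependence.
Variables (k : fieldType) (n m : nat) (g : 'I_m -> {mpoly k[n]}).
Local Notation S := {mpoly k[n]}.

Definition mnm_eval (mu : 'X_{1..m}) : S := \prod_i g i ^+ mu i.

Lemma mnm_evalD mu nu : mnm_eval (mu + nu) = mnm_eval mu * mnm_eval nu.
Proof. by rewrite -big_split; apply: eq_bigr => i _ /=; rewrite mnmDE exprD. Qed.

Lemma mcoeff_mdeg_gt (D : nat) (a : S) mu :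
  (msize a <= D.+1)%N -> (D < mdeg mu)%N -> a@_mu = 0.
Proof. by move=> aD Dmu; apply/memN_msupp_eq0/msize_mdeg_ge/(leq_trans aD). Qed.

Lemma msizeM_leS (D D' : nat) (a b : S) :
  (msize a <= D.+1)%N -> (msize b <= D'.+1)%N -> (msize (a * b) <= (D + D').+1)%N.
Proof.
move=> aD bD; have [->|a0] := eqVneq a 0; first by rewrite mul0r msize0.
have [->|b0] := eqVneq b 0; first by rewrite mulr0 msize0.
rewrite msizeM //; move: (msize a) (msize b) aD bD => x y; lia.
Qed.

Lemma mnm_eval_msize (D : nat) (mu : 'X_{1..m}) :
  (forall i, msize (g i) <= D.+1)%N -> (msize (mnm_eval mu) <= (mdeg mu * D).+1)%N.
Proof.
move=> gD; rewrite mdegE big_distrl /=; rewrite /mnm_eval.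
elim/big_ind2: _ => [|a d b e|i _]; [by rewrite msize1 | exact: msizeM_leS |].
elim: (mu i) => [|e IHe]; first by rewrite expr0 msize1.
by rewrite exprS mulSn; apply: msizeM_leS.
Qed.

Lemma algebraic_dependence : (n < m)%N ->
  exists2 P : {mpoly k[m]}, P != 0 &
    \sum_(mu <- msupp P) P@_mu *: mnm_eval mu = 0.
Proof.
move=> nm.
(* Exponents below N give N^m products, whose monomials have exponents below M <= C N. Since N >
   C^n, M^n <= C^n N^n < N^(n+1) <= N^m, which forces a linear relation. *)
pose D := \max_i msize (g i); pose C := (m * D).+1; pose N := (C ^ n).+1.
have gD i : (msize (g i) <= D.+1)%N by apply/leqW/leq_bigmax.
pose M := (m * N * D).+1.
have MCN : (M <= C * N)%N by rewrite /M /C mulSn mulnAC; lia.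
pose box1 := {ffun 'I_m -> 'I_N}; pose box2 := {ffun 'I_n -> 'I_M}.
pose mon1 (al : box1) : 'X_{1..m} := [multinom (al i : nat) | i < m].
pose mon2 (al : box2) : 'X_{1..n} := [multinom (al i : nat) | i < n].
have mon1_inj : injective mon1.
  move=> al be /mnmP ab; apply/ffunP => i; apply: val_inj.
  by have := ab i; rewrite !mnmE.
pose A : 'M[k]_(#|box1|, #|box2|) :=
  \matrix_(i, j) (mnm_eval (mon1 (enum_val i)))@_(mon2 (enum_val j)).
have /rowV0Pn[v /sub_kermxP vA v0] : kermx A != 0.
  rewrite -mxrank_eq0 mxrank_ker subn_eq0 -ltnNge.
  apply: leq_ltn_trans (rank_leq_col A) _.
  rewrite !card_ffun !card_ord.
  have /leq_ltn_trans -> // : (M ^ n <= (C * N) ^ n)%N.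
    by case: (n) => // n'; rewrite leq_exp2r.
  rewrite expnMn; apply: (@leq_trans (N ^ n.+1)); last exact: leq_pexp2l.
  by rewrite expnS ltn_pmul2r // expn_gt0.
pose P : {mpoly k[m]} := \sum_e v 0 e *: 'X_[mon1 (enum_val e)].
have PE e : P@_(mon1 (enum_val e)) = v 0 e.
  rewrite /P raddf_sum /= (bigD1 e) //= big1 => [|e' e'e].
    by rewrite addr0 mcoeffZ mcoeffX eqxx mulr1.
  rewrite mcoeffZ mcoeffX; case: eqP => [/mon1_inj/enum_val_inj ee|_].
    by rewrite ee eqxx in e'e.
  by rewrite mulr0.
exists P.
  by apply: contraNneq v0 => P0; apply/eqP/rowP => e; rewrite mxE -PE P0 mcoeff0.
have -> : \sum_(mu <- msupp P) P@_mu *: mnm_eval mu = P \mPo [tuple g i | i < m].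
  rewrite comp_mpolyE; apply: eq_bigr => mu _; congr (_ *: _).
  by apply: eq_bigr => i _; rewrite tnth_mktuple.
have -> : P \mPo [tuple g i | i < m] = \sum_e v 0 e *: mnm_eval (mon1 (enum_val e)).
  rewrite /P raddf_sum; apply: eq_bigr => e _ /=.
  rewrite comp_mpolyZ comp_mpolyX; congr (_ *: _).
  by apply: eq_bigr => i _; rewrite tnth_mktuple.
apply/mpolyP => nu; rewrite mcoeff0 raddf_sum /=.
have [nuM|Mnu] := boolP [forall i, (nu i < M)%N].
  pose be : box2 := [ffun i => Ordinal (forallP nuM i)].
  have nuE : nu = mon2 be by apply/mnmP => i; rewrite mnmE ffunE.
  have := congr1 (fun w : 'rV_#|box2| => w 0 (enum_rank be)) vA; rewrite !mxE => vA0.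
  rewrite -[RHS]vA0; apply: eq_bigr => e _.
  by rewrite mcoeffZ mxE enum_rankK -nuE.
apply: big1 => e _; rewrite mcoeffZ.
rewrite (mcoeff_mdeg_gt (mnm_eval_msize (mon1 (enum_val e)) gD)) ?mulr0 //.
move: Mnu; rewrite negb_forall => /existsP[i]; rewrite -leqNgt => Mi.
have iD : (nu i <= mdeg nu)%N by rewrite mdegE (bigD1 i) //= leq_addr.
apply: leq_trans (leq_trans Mi iD); rewrite ltnS leq_mul2r; apply/orP; right.
rewrite mdegE -[X in (_ <= X * _)%N]card_ord -sum_nat_const.
by apply: leq_sum => j _; rewrite mnmE ltnW.
Qed.

Lemma sub_multinom d (mu : 'X_{1..m}) : (d <= mdeg mu)%N ->
  exists nu, mdeg nu = d /\ (nu <= mu)%MM.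
Proof.
elim: d => [|d IHd] dmu; first by exists 0%MM; split; [exact: mdeg0 | apply/mnm_lepP => i; rewrite mnm0E].
have [nu [nud nu_mu]] := IHd (ltnW dmu).
have [i nui] : exists i, (nu i < mu i)%N.
  apply/existsP; apply: contraTT dmu => /existsPn le_mu.
  rewrite -ltnNge ltnS -nud mdegE [X in (_ <= X)%N]mdegE; apply: leq_sum => i _.
  by rewrite leqNgt.
exists (nu + U_(i))%MM; rewrite mdegD mdeg1 nud addn1; split=> //.
apply/mnm_lepP => l; rewrite mnmDE mnm1E; case: eqP => [<-|_]; first by rewrite addn1.
by rewrite addn0; apply/mnm_lepP.
Qed.

(* More equations than variables: an algebraic relation, rewritten as a form whose
   coefficients of lowest degree are constants modulo [(g)], contradicts
   quasi-regularity unless [(g)] is the unit ideal. *)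
Lemma koszul_acyclic1_unit : [pchar k] =i pred0 -> (n < m)%N ->
    (forall c : 'I_m -> S, \sum_i c i * g i = 0 ->
      exists t : 'I_m -> 'I_m -> S, forall i, c i = \sum_j (t i j - t j i) * g j) ->
  exists v : 'I_m -> S, 1 = \sum_i v i * g i.
Proof.
move=> char0 nm H1; have [P P0 Pg] := algebraic_dependence nm.
pose I (a : S) := exists v : 'I_m -> S, a = \sum_i v i * g i.
have IMD a b c : I b -> I c -> I (a * b + c).
  move=> [v ->] [w ->]; exists (fun i => a * v i + w i).
  by rewrite mulr_sumr -big_split; apply: eq_bigr => i _ /=; rewrite mulrDl mulrA.
have I0 : I 0 by exists (fun=> 0); rewrite big1 // => i _; rewrite mul0r.
have IM a b : I b -> I (a * b) by move=> Ib; rewrite -[_ * _]addr0; apply: IMD.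
have ID b c : I b -> I c -> I (b + c) by move=> *; rewrite -[b]mul1r; apply: IMD.
have Ig i : I (g i).
  exists (fun j => (j == i)%:R); rewrite (bigD1 i) //= eqxx mul1r big1 ?addr0 //.
  by move=> j /negPf ->; rewrite mul0r.
have exd : exists d, has (fun mu => mdeg mu == d) (msupp P).
  have /hasP[mu muP _] : has predT (msupp P) by rewrite has_predT lt0n size_eq0 msupp_eq0.
  by exists (mdeg mu); apply/hasP; exists mu.
case: (ex_minnP exd) => d /hasP[mu0 mu0P /eqP mu0d] dmin.
have dle mu : mu \in msupp P -> (d <= mdeg mu)%N.
  by move=> muP; apply: dmin; apply/hasP; exists mu.
(* Each monomial of P keeps a factor [sub mu] of the lowest degree d; the cofactor is evaluated at
   [g], giving a form F of degree d with F(g) = P(g) = 0. *)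
have exsub mu : exists nu : 'X_{1..m}, mu \in msupp P -> mdeg nu = d /\ (nu <= mu)%MM.
  have [muP|_] := boolP (mu \in msupp P); last by exists mu.
  by have [nu nuE] := sub_multinom (dle mu muP); exists nu.
have [sub subP] := choice exsub.
pose F : {mpoly S[m]} :=
  \sum_(mu <- msupp P) (P@_mu *: mnm_eval (mu - sub mu)) *: 'X_[sub mu].
have Fd : F \is d.-homog.
  rewrite /F big_seq; apply: rpred_sum => mu /subP[sd _]; apply: rpredZ.
  by rewrite dhomogX; apply/eqP.
have Fg : F.@[g] = 0.
  rewrite -[RHS]Pg /F raddf_sum big_seq [RHS]big_seq; apply: eq_bigr => mu /subP[_ smu].
  by rewrite /= mevalZ mevalX -scalerAl -mnm_evalD submK.
have [|w _ Fw] := koszul_quasi_regular H1 _ Fd Fg.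
  move=> e e0; exists ((e%:R^-1)%:MP).
  rewrite -mpolyC_nat -mpolyCM mulVf ?mpolyC1 //.
  by rewrite ((pcharf0P _).1 char0) -lt0n.
have IF : I F@_mu0.
  rewrite Fw raddf_sum /=; apply: big_rec => // i a _ Ia; apply: ID => //.
  by rewrite mcoeffZ mulrC; apply: IM.
have le_mdeg_eq (nu mu : 'X_{1..m}) : (nu <= mu)%MM -> mdeg nu = mdeg mu -> nu = mu.
  move=> num; rewrite -[in mdeg mu](submK num) mdegD -[LHS]add0n => /addIn/esym/eqP.
  by rewrite mdeg_eq0 => /eqP num0; rewrite -(submK num) num0 add0m.
have [v vE] : I (P@_mu0)%:MP.
  (* What the other monomials contribute to the coefficient at [mu0]: each nonzero term carries a
     nontrivial product of the g_i, so Q lies in (g). *)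
  pose Q : S := \sum_(mu <- msupp P | mu != mu0)
    (P@_mu *: mnm_eval (mu - sub mu)) * (sub mu == mu0)%:R.
  have FE : F@_mu0 = (P@_mu0)%:MP + Q.
    rewrite /F raddf_sum /= (bigD1_seq mu0) //= mcoeffZ mcoeffX.
    have [sd smu] := subP _ mu0P; rewrite (le_mdeg_eq _ _ smu) ?sd // eqxx mulr1.
    congr (_ + _); last by apply: eq_bigr => mu _; rewrite mcoeffZ mcoeffX.
    have -> : (mu0 - mu0)%MM = 0%MM by apply/mnmP => i; rewrite mnmBE subnn mnm0E.
    by rewrite /mnm_eval big1 ?alg_mpolyC // => i _; rewrite mnm0E expr0.
  have -> : (P@_mu0)%:MP = -1 * Q + F@_mu0 :> S by rewrite mulN1r FE addrC addrK.
  apply: (IMD (-1)) => //; rewrite /Q.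
  rewrite big_seq_cond; apply: big_rec => // mu b /andP[muP mu_mu0] Ib.
  apply: ID => //; have [sd smu] := subP _ muP.
  have [smu0|_] := eqVneq (sub mu) mu0; last by rewrite mulr0.
  rewrite mulr1 -mul_mpolyC; apply: (IM).
  have [i] : exists i, (mu - sub mu)%MM i != 0%N.
    apply/existsP; apply: contra_neqT mu_mu0 => /existsPn mu_sub.
    rewrite -[LHS](submK smu) -[RHS]smu0; suff -> : (mu - sub mu)%MM = 0%MM by rewrite add0m.
    by apply/mnmP => i; rewrite mnm0E; have := mu_sub i; rewrite negbK => /eqP.
  rewrite -lt0n => i0; rewrite /mnm_eval (bigD1 i) //= -(prednK i0) exprS.
  by rewrite -mulrA mulrC; apply: (IM).
have Pmu0 : P@_mu0 != 0 by rewrite -mcoeff_msupp.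
have : I 1.
  have -> : 1 = ((P@_mu0)^-1)%:MP * (P@_mu0)%:MP :> S.
    by rewrite -mpolyCM mulVf ?mpolyC1.
  by rewrite vE; apply: IM; exists v.
by [].
Qed.
End AlgebraicDependence.

(** * Essential derivations as Koszul homology *)

Section Hypersurface.
Variables (k : fieldType) (n : nat) (f : {mpoly k[n]}).
Hypothesis f_neq0 : f != 0.
Local Notation S := {mpoly k[n]}.

Lemma der_sumE (c : 'I_n -> S) (g : S) :
  (\sum_i c i *: partial k i) g = \sum_i c i * g^`M(i).
Proof. by elim/big_ind2: _ => // d1 a1 d2 a2 <- <-. Qed.

Lemma der_partialE (d : der S) g : d g = \sum_i d 'X_i * g^`M(i).
Proof. by rewrite {1}[d]der_coordE der_sumE. Qed.

Lemma der_expS (d : der S) (g : S) e : d (g ^+ e.+1) = e.+1%:R * g ^+ e * d g.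
Proof.
elim: e => [|e IHe]; first by rewrite !expr1 expr0 mulr1 mul1r.
rewrite exprS (derP d).2 IHe [in RHS]mulrS.
by move: (d g) (e.+1%:R : S) => D u; rewrite !exprS; ring.
Qed.

Lemma der_mpolyC (d : der S) (c : k) : d c%:MP = 0.
Proof. by rewrite der_partialE big1 // => i _; rewrite mderivC mulr0. Qed.

Lemma derB (d : der S) a b : d (a - b) = d a - d b.
Proof.
rewrite !(der_partialE d) -sumrB; apply: eq_bigr => i _.
by rewrite mderivB mulrBr.
Qed.

(* [f] itself has index [n], after its partial derivatives. *)
Definition der_gens : nat -> S := ordfam (fun i => f^`M(i)) f.
Local Notation F := der_gens.

Lemma der_gens_lt (i : 'I_n) : F i = f^`M(i). Proof. exact: ordfamE. Qed.
Lemma der_gens_last : F n = f. Proof. exact: ordfam_ge. Qed.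

Definition koszul_partial (i j : 'I_n) : derlog f :=
  Sub (f^`M(i) *: partial k j - f^`M(j) *: partial k i)
    (proj1 (andP (koszul_derlog f i j))).
Definition koszul_self (i : 'I_n) : derlog f :=
  Sub (f *: partial k i) (proj2 (andP (koszul_derlog f i i))).

Local Notation kspan := (Defs.span (@koszul k n f)).

Lemma koszul_partial_span i j : koszul_partial i j \in kspan.
Proof. by apply: mem_span; left; exists i, j; rewrite SubK. Qed.
Lemma koszul_self_span i : koszul_self i \in kspan.
Proof. by apply: mem_span; right; exists i; rewrite SubK. Qed.

Lemma partialX (i l : 'I_n) : partial k i 'X_l = (i == l)%:R.
Proof.
rewrite /= mderivX mnm1E eq_sym; case: eqP => [->|_]; last by rewrite scale0r.
suff -> : (U_(l) - U_(l))%MM = 0%MM by rewrite mpolyX0 scale1r.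
by apply/mnmP => j; rewrite mnmBE subnn mnm0E.
Qed.

Lemma der_bigE I (s : seq I) (d : I -> der S) a :
  (\sum_(i <- s) d i) a = \sum_(i <- s) d i a.
Proof. by elim/big_ind2: _ => // d1 a1 d2 a2 <- <-. Qed.

Lemma koszul_partialX i j l :
  val (koszul_partial i j) 'X_l = f^`M(i) * (j == l)%:R - f^`M(j) * (i == l)%:R.
Proof. by rewrite SubK der_addE der_oppE !der_scaleE !partialX. Qed.

Lemma koszul_selfX i l : val (koszul_self i) 'X_l = f * (i == l)%:R.
Proof. by rewrite SubK der_scaleE partialX. Qed.

Lemma derlogE (d e : derlog f) : (forall i, val d 'X_i = val e 'X_i) -> d = e.
Proof.
move=> de; apply: val_inj; rewrite [LHS]der_coordE [RHS]der_coordE.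
by apply: eq_bigr => i _; rewrite de.
Qed.

Lemma derlog_bigE I (s : seq I) (x : I -> derlog f) a :
  val (\sum_(i <- s) x i) a = \sum_(i <- s) val (x i) a.
Proof. by rewrite raddf_sum der_bigE. Qed.

Lemma derlog_scaleE c (x : derlog f) a : val (c *: x) a = c * val x a.
Proof. by rewrite linearZ. Qed.

Lemma derlog_addE (x y : derlog f) a : val (x + y) a = val x a + val y a.
Proof. by rewrite linearD. Qed.

Lemma sum_delta (h : 'I_n -> S) l : \sum_i h i * (i == l)%:R = h l.
Proof.
rewrite (bigD1 l) //= eqxx mulr1 big1 ?addr0 // => i /negPf ->.
by rewrite mulr0.
Qed.

Lemma antisym_span (d : derlog f) (c : 'I_n -> 'I_n -> S) :
  (forall i, val d 'X_i = \sum_j (c i j - c j i) * f^`M(j)) ->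
  d \in kspan.
Proof.
move=> dE.
suff -> : d = \sum_i \sum_j c i j *: koszul_partial j i.
  apply: rpred_sum => i _; apply: rpred_sum => j _.
  exact/rpredZ/koszul_partial_span.
apply: derlogE => l; rewrite dE derlog_bigE.
under [RHS]eq_bigr => i _.
  rewrite derlog_bigE.
  under eq_bigr do rewrite derlog_scaleE koszul_partialX mulrBr !mulrA.
  rewrite sumrB -mulr_suml sum_delta.
  over.
rewrite sumrB sum_delta -sumrB; apply: eq_bigr => j _.
by rewrite mulrBl.
Qed.

Lemma smooth_essder (x : derlog f) : smooth_hypersurface f -> x \in kspan.
Proof.
move=> /(_ 1)/gen_idealP[r [c [a [aE one]]]].
rewrite -[x]scale1r one scaler_suml; apply: rpred_sum => l _.
rewrite -scalerA; apply: rpredZ.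
have /derlog_predP[g xf] := valP x.
have [->|[j ->]] := aE l.
  suff -> : f *: x = \sum_i val x 'X_i *: koszul_self i.
    apply: rpred_sum => i _; exact/rpredZ/koszul_self_span.
  apply: derlogE => m; rewrite derlog_scaleE derlog_bigE.
  under eq_bigr do rewrite derlog_scaleE koszul_selfX mulrA.
  by rewrite sum_delta mulrC.
(* The subtracted parts of the Koszul derivations sum to x(f) = f g times the j-th partial; the last
   term restores it. *)
suff -> : f^`M(j) *: x =
    \sum_i val x 'X_i *: koszul_partial j i + g *: koszul_self j.
  apply: rpredD; last exact/rpredZ/koszul_self_span.
  by apply: rpred_sum => i _; exact/rpredZ/koszul_partial_span.
apply: derlogE => m; rewrite derlog_addE !derlog_scaleE derlog_bigE.
under eq_bigr do rewrite derlog_scaleE koszul_partialX mulrBr !mulrA.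
rewrite sumrB -mulr_suml -der_partialE xf koszul_selfX mulrA [g * f]mulrC subrK.
by rewrite sum_delta mulrC.
Qed.

Lemma der_gens_cases l : (l < n.+1)%N -> (exists i : 'I_n, l = i) \/ l = n.
Proof.
rewrite ltnS leq_eqVlt => /predU1P[|ln]; first by right.
by left; exists (Ordinal ln).
Qed.

(** The dictionary from Koszul derivations to Koszul boundaries, for the syzygy with last entry q =
    - x(f) / f; [phi] will be the identity or localization. *)
Lemma span_boundary (R : comNzRingType) (phi : {rmorphism S -> R}) (x : derlog f) q :
  x \in kspan -> val x f = - (f * q) ->
  boundary (fun l => phi (F l)) n.+1
    (fun l => phi (ordfam (fun i => val x 'X_i) q l)).
Proof.
move=> xK xq.
(* The last entry is quantified so that linear combinations stay good; it is unique because [f] is a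
   nonzerodivisor. *)
pose good (y : derlog f) := exists q, val y f = - (f * q) /\
  boundary (fun l => phi (F l)) n.+1
    (fun l => phi (ordfam (fun i => val y 'X_i) q l)).
have good0 : good 0.
  exists 0; rewrite mulr0 oppr0; split=> //.
  apply: eq_boundary (boundary0 _ _) => l /der_gens_cases[[i ->]|->].
    by rewrite ordfamE rmorph0.
  by rewrite ordfam_ge ?rmorph0.
have goodZD c y z : good y -> good z -> good (c *: y + z).
  move=> [qy [yq yB]] [qz [zq zB]]; exists (c * qy + qz); split.
    by rewrite derlog_addE derlog_scaleE yq zq; ring.
  apply: eq_boundary (boundaryZD (phi c) yB zB) => l /der_gens_cases[[i ->]|->].
    by rewrite !ordfamE derlog_addE derlog_scaleE rmorphD rmorphM.
  by rewrite !ordfam_ge // rmorphD rmorphM.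
have goodK y : koszul y -> good y.
  move=> [[i [j yE]]|[i yE]].
    exists 0; split.
      by rewrite yE der_addE der_oppE !der_scaleE /= mulr0 oppr0 mulrC subrr.
    have := boundary_pair (fun l => phi (F l)) (leqW (ltn_ord i)) (leqW (ltn_ord j)).
    apply: eq_boundary => l /der_gens_cases[[m ->]|->].
      rewrite ordfamE yE der_addE der_oppE !der_scaleE !partialX !der_gens_lt.
      by rewrite rmorphB !rmorphM !rmorph_nat eq_sym [i == _]eq_sym.
    by rewrite ordfam_ge // rmorph0 !gtn_eqF // !mulr0 subr0.
  exists (- f^`M(i)); split; first by rewrite yE der_scaleE mulrN opprK.
  have := boundary_pair (fun l => phi (F l)) (ltnSn n) (leqW (ltn_ord i)).
  apply: eq_boundary => l /der_gens_cases[[m ->]|->].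
    rewrite ordfamE yE der_scaleE partialX der_gens_last rmorphM rmorph_nat.
    by rewrite [m == n :> nat]ltn_eqF // mulr0 subr0 eq_sym.
  by rewrite ordfam_ge // der_gens_lt gtn_eqF // mulr0 sub0r eqxx mulr1 rmorphN.
have [q' [xq' xB]] : good x.
  move/spanP: xK => [r [c [a [aK ->]]]]; apply: big_rec => // i y _.
  by apply: goodZD; apply: goodK.
suff -> : q = q' by [].
by apply: (mulfI f_neq0); apply: oppr_inj; rewrite -xq.
Qed.

Lemma essder0_smooth : [pchar k] =i pred0 -> (forall x : derlog f, x \in kspan) ->
  smooth_hypersurface f.
Proof.
move=> char0 dK.
have [c cF|v one] := @koszul_acyclic1_unit k n n.+1 (fun i => F i) char0 (ltnSn n).
  (* A syzygy of the n + 1 generators is read as a derivation with d(f) = - f c_n, hence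
     logarithmic. *)
  pose d : der S := \sum_(i < n) c (widen_ord (leqnSn n) i) *: partial k i.
  have df : d f = - (f * c ord_max).
    rewrite der_sumE; move: cF; rewrite big_ord_recr /= der_gens_last.
    under eq_bigr do rewrite der_gens_lt.
    by move=> /eqP; rewrite addr_eq0 mulrC => /eqP.
  have dlog : d \in derlog_pred f.
    by apply/derlog_predP; exists (- c ord_max); rewrite mulrN.
  have [|w wE] := @span_boundary S idfun (Sub d dlog) (c ord_max) (dK _).
    by rewrite SubK.
  have [t tE] := boundary_antisym F w.
  exists (fun i j => t i j) => i.
  have := congr1 (@degpart S 1 n.+1) wE; rewrite degpart_vec tE.
  move=> /vec_inj/(_ i (ltn_ord i)) <- /=.
  case: (der_gens_cases (ltn_ord i)) => [[j ij]|iN].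
    rewrite ij ordfamE [RHS]partial_coord; congr c.
    exact: val_inj.
  by rewrite iN ordfam_ge //; congr c; apply: val_inj.
move=> g; rewrite -[g]mulr1; apply: gen_idealMl; rewrite one.
apply: rpred_sum => i _; apply: gen_idealMl; apply: mem_gen_ideal.
case: (der_gens_cases (ltn_ord i)) => [[j ->]|->].
  by right; exists j; rewrite der_gens_lt.
by left; rewrite der_gens_last.
Qed.

End Hypersurface.

(** * Logarithmic derivations at an isolated singular point *)

Section LocalHypersurface.
Variables (k : fieldType) (n : nat) (f : {mpoly k[n]}) (p : 'I_n -> k).
Hypothesis f_neq0 : f != 0.
Local Notation S := {mpoly k[n]}.
Local Notation P := (point_ideal p).
Local Notation R := (locring P).
Local Notation F := (der_gens f).
Local Notation FR := (fun l => loc p (der_gens f l)).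
Local Notation kspan := (Defs.span (@koszul k n f)).

Lemma gen_ideal_genby (A : S -> Prop) (T : comNzRingType) (phi : {rmorphism S -> T})
    (E : nat -> T) m a :
  (forall b, A b -> genby E m (phi b)) -> a \in gen_ideal A -> genby E m (phi a).
Proof.
move=> AE /gen_idealP[r [c [b [bA ->]]]]; rewrite rmorph_sum.
apply: big_rec => [|i x _]; first exact: genby0.
by rewrite rmorphM; apply: genbyZD; apply: AE.
Qed.

Lemma jacobian_genby (T : comNzRingType) (phi : {rmorphism S -> T}) a :
  a \in jacobian_ideal f -> genby (fun l => phi (F l)) n (phi a).
Proof.
apply: gen_ideal_genby => b [i ->]; rewrite -der_gens_lt.
exact: (genby_gen (fun l => phi (F l))).
Qed.

Lemma singular_genby (T : comNzRingType) (phi : {rmorphism S -> T}) a :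
  a \in singular_ideal f -> genby (fun l => phi (F l)) n.+1 (phi a).
Proof.
apply: gen_ideal_genby => b [->|[i ->]].
  rewrite -[in phi f](der_gens_last f); exact: (genby_gen (fun l => phi (F l))).
rewrite -der_gens_lt; apply: (genby_gen (fun l => phi (F l))); exact: leqW.
Qed.

Lemma locideal_genby (I : {pred S}) (E : nat -> R) m (x : R) :
  (forall a, a \in I -> genby E m (loc p a)) -> locideal I x -> genby E m x.
Proof.
move=> IE [a [s [aI ->]]]; have [v vs] : exists v, v * loc p (den_val s) = 1.
  by apply: loc_unit; have := denP s; rewrite mem_point_ideal.
have -> : @locfrac S P S^o a s = v * loc p a :> R by rewrite -(locE a s) mulrA vs mul1r.
exact/genbyZ/IE.
Qed.

Lemma locideal_loc (I : {pred S}) a : locideal I (loc p a) ->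
  exists u b, [/\ u.@[p] != 0, b \in I & u * a = b].
Proof.
move=> [b [s [bI /(locfrac_eqP _ _ (denom1 P) s).1 sa]]]; rewrite /= mul1r in sa.
exists (den_val s), b; split=> //.
by have := denP s; rewrite mem_point_ideal.
Qed.

Lemma loc_locideal (I : {pred S}) a : a \in I -> locideal I (loc p a).
Proof. by exists a, (denom1 P). Qed.

Lemma mem_singular l : (l < n.+1)%N -> F l \in singular_ideal f.
Proof.
move=> /der_gens_cases[[i ->]|->]; apply: mem_gen_ideal.
  by right; exists i; rewrite der_gens_lt.
by left; rewrite der_gens_last.
Qed.

(** Commuting x with a partial derivative gives x(f_j) as the j-th partial of x(f) = f g minus a
    combination of the f_i. *)
Lemma der_singular (x : derlog f) a :
  a \in singular_ideal f -> val x a \in singular_ideal f.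
Proof.
have fI : f \in singular_ideal f by have := mem_singular (ltnSn n); rewrite der_gens_last.
have fiI i : f^`M(i) \in singular_ideal f by have := mem_singular (leqW (ltn_ord i)); rewrite der_gens_lt.
have /derlog_predP[g xf] := valP x.
move=> /gen_idealP[r [c [b [bA ->]]]].
rewrite der_partialE; under eq_bigr do rewrite raddf_sum mulr_sumr.
rewrite exchange_big; apply: rpred_sum => l _ /=.
under eq_bigr do rewrite mderivM mulrDr mulrA [X in _ + X]mulrCA.
rewrite big_split /= -mulr_suml -mulr_sumr; apply: rpredD.
  apply: gen_idealMl.
  by have [->|[j ->]] := bA l.
apply: gen_idealMl; rewrite -der_partialE.
have [->|[j ->]] := bA l; first by rewrite xf mulrC gen_idealMl.
have -> : val x f^`M(j) = (val x f)^`M(j) - \sum_i (val x 'X_i)^`M(j) * f^`M(i).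
  rewrite der_partialE [val x f]der_partialE raddf_sum -sumrB; apply: eq_bigr => i _ /=.
  by rewrite mderivM addrC addKr mderiv_comm.
apply: rpredB; last by apply: rpred_sum => i _; apply: gen_idealMl.
by rewrite xf mderivM; apply: rpredD; rewrite mulrC; apply: gen_idealMl.
Qed.

Hypothesis char0 : [pchar k] =i pred0.
Hypothesis f_iso : isolated_singular_point p f.

(* A logarithmic derivation preserves the singular ideal; if it moved [X_i] it would
   differentiate [(X_i - p_i)^N] down to a unit of that ideal. *)
Lemma derlog_vanish (x : derlog f) i : (val x 'X_i).@[p] = 0.
Proof.
have [IP [_ _ PI]] := f_iso.
apply/eqP; apply: contraT => xi0.
pose y : S := 'X_i - (p i)%:MP.
have xy : val x y = val x 'X_i by rewrite derB der_mpolyC subr0.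
(* [u] carries the denominators: membership in the local ideal is membership after multiplication by
   a polynomial nonzero at p. *)
suff no N u : u.@[p] != 0 -> u * y ^+ N \notin singular_ideal f.
  have yP : y \in (P : {pred S}) by rewrite mem_point_ideal mevalB mevalXU mevalC subrr.
  have [j] := (PI (loc p y)).1 (loc_locideal yP).
  rewrite -rmorphXn => /locideal_loc[u [b [u0 bI uy]]].
  by have := no j u u0; rewrite uy bI.
elim: N u => [|N IHN] u u0.
  rewrite expr0 mulr1; apply: contra u0 => /IP.
  by rewrite mem_point_ideal.
apply/negP => uyI.
pose w := u * u * (N.+1%:R * val x 'X_i).
have w0 : w.@[p] != 0.
  rewrite !mevalM !mulf_neq0 // -mpolyC_nat mevalC.
  by rewrite ((pcharf0P _).1 char0).
have /negP := IHN w w0; apply.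
(* By Leibniz, the subtracted term cancels the derivative of [u]; in characteristic zero the factor
   N + 1 stays nonzero at p. *)
have -> : w * y ^+ N = u * val x (u * y ^+ N.+1) - val x u * (u * y ^+ N.+1).
  rewrite (derP (val x)).2 der_expS xy /w.
  by move: (val x u) (val x 'X_i) (N.+1%:R : S) (y ^+ N.+1) => a b c d; ring.
by apply: rpredB; apply: gen_idealMl => //; apply: der_singular.
Qed.

Lemma singular_at_point l : (l < n.+1)%N -> (F l).@[p] = 0.
Proof.
by have [IP _] := f_iso; move=> /mem_singular/IP; rewrite mem_point_ideal => /eqP.
Qed.

Lemma loc_xpow_singular : exists2 N, (0 < N)%N & forall i, (i < n)%N ->
  locideal (singular_ideal f) (loc_xpow (loc_shift p) N i).
Proof.
have [_ [_ _ PI]] := f_iso.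
have ex (i : 'I_n) : exists e, locideal (singular_ideal f) (loc p ('X_i - (p i)%:MP) ^+ e).
  apply/PI/loc_locideal; rewrite mem_point_ideal.
  by rewrite mevalB mevalXU mevalC subrr.
have [e eI] := choice ex.
exists (\max_i e i).+1 => // i ilt; rewrite -[i]/(val (Ordinal ilt)) loc_shift_xpow.
have le_e : (e (Ordinal ilt) <= (\max_i e i).+1)%N by apply/leqW/leq_bigmax.
rewrite -(subnK le_e) exprD -rmorphXn.
have [b [s [bI bs]]] := eI (Ordinal ilt).
exists (('X_(Ordinal ilt) - (p (Ordinal ilt))%:MP) ^+ ((\max_i e i).+1 - e (Ordinal ilt)) * b), s.
split; first exact: gen_idealMl.
rewrite bs [LHS]loc_mulE; apply/locfrac_eqP; by rewrite /= mul1r.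
Qed.

Lemma loc_denom (I : finType) (c : I -> R) :
  exists s (b : I -> S), s.@[p] != 0 /\ forall i, loc p s * c i = loc p (b i).
Proof.
have ex i := loc_frac (c i).
have [s sE] := choice ex; have [b bE] := choice sE.
exists (\prod_i s i), (fun i => \prod_(j | j != i) s j * b i); split=> [|i].
  rewrite rmorph_prod; apply/prodf_neq0 => i _; by case: (bE i).
rewrite (bigD1 i) //= !rmorphM /= mulrC mulrA [c i * _]mulrC (bE i).2.
by rewrite mulrC.
Qed.

(** Cyclicity with denominators cleared: they act invertibly, so a generator may be taken among the
    numerators. *)
Definition locally_cyclic := exists x0 : derlog f, forall x : derlog f,
  exists u a, u.@[p] != 0 /\ u *: x - a *: x0 \in kspan.

Definition essder_class (x : derlog f) : essder f := (\pi_(quotmod kspan) x)%qT.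

Lemma essder_classZ a x : a *: essder_class x = essder_class (a *: x).
Proof. exact/esym/quotmod_piZ. Qed.

Lemma essder_class_eq x y : essder_class x = essder_class y <-> x - y \in kspan.
Proof. exact: quotmod_piP. Qed.

Lemma essder_classP (e : essder f) : exists x, e = essder_class x.
Proof. by elim/quotmodW: e => x; exists x. Qed.

Lemma cyclic_essderP : cyclic_module (locmod P (essder f)) <-> locally_cyclic.
Proof.
split=> [[m mE]|[x0 x0E]].
  have [[e s0] /= m0E] := locfracE m; have [x0 x0E] := essder_classP e.
  exists x0 => x; have [a] := mE (locfrac (essder_class x) (denom1 P)).
  have [[b t] /= ->] := locfracE a; rewrite m0E x0E locfracZ => /locfracP[u].
  rewrite !scalerA /= mulr1 !essder_classZ => /essder_class_eq xK.
  exists (den_val u * (den_val t * den_val s0)), (den_val u * b); split=> //.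
  by have := denP (denomM u (denomM t s0)); rewrite mem_point_ideal.
exists (locfrac (essder_class x0) (denom1 P)) => y.
have [[e s] /= ->] := locfracE y; have [x ->] := essder_classP e.
have [u [a [u0 xK]]] := x0E x.
have uP : u \notin (P : {pred S}) by rewrite mem_point_ideal.
exists (@locfrac S P S^o a (denomM (Denom uP) s)).
rewrite locfracZ; apply/locfracP; exists (denom1 P) => /=.
rewrite !scale1r mulr1 !scalerA !essder_classZ.
apply: (essder_class_eq _ _).2.
rewrite [u * den_val s]mulrC -!scalerA -scalerBr.
exact: rpredZ.
Qed.

Lemma quasihomogeneousP :
  quasihomogeneous_at p f <->
  exists u (b : 'I_n -> S), u.@[p] != 0 /\ u * f = \sum_i b i * f^`M(i).
Proof.
split=> [qh|[u [b [u0 ufE]]] x]; last first.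
  have uP : u \notin (P : {pred S}) by rewrite mem_point_ideal.
  have Jf : u * f \in jacobian_ideal f.
    rewrite ufE; apply: rpred_sum => i _; apply: gen_idealMl.
    by apply: mem_gen_ideal; exists i.
  split=> [[a [s [aJ ->]]]|[a [s [aI ->]]]].
    exists a, s; split=> //; have /gen_idealP[r [c [d [dJ ->]]]] := aJ.
    apply: rpred_sum => i _; apply: gen_idealMl; apply: mem_gen_ideal.
    by right; apply: dJ.
  exists (u * a), (denomM (Denom uP) s); split; last first.
    by apply/locfrac_eqP => /=; ring.
  have /gen_idealP[r [c [d [dI ->]]]] := aI; rewrite mulr_sumr.
  apply: rpred_sum => i _; rewrite mulrCA; apply: gen_idealMl.
  have [->//|[j ->]] := dI i; apply: gen_idealMl; apply: mem_gen_ideal.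
  by exists j.
have fI : f \in singular_ideal f by apply: mem_gen_ideal; left.
have [u [b [u0 bJ ub]]] := locideal_loc ((qh _).2 (loc_locideal fI)).
have [v] := jacobian_genby idfun bJ; rewrite /= -ub => ufE.
exists u, (fun i => v i); split=> //; rewrite ufE; apply: eq_bigr => i _.
by rewrite der_gens_lt.
Qed.

Lemma quasihomogeneous_cyclic : quasihomogeneous_at p f -> locally_cyclic.
Proof.
move=> qh; have [u [b [u0 ufE]]] := quasihomogeneousP.1 qh.
have [N N0 Nsing] := loc_xpow_singular.
pose Y := loc_xpow (loc_shift p) N.
have YF i : (i < n)%N -> genby FR n (Y i).
  move=> /Nsing /qh; apply: locideal_genby => a; exact: (jacobian_genby (loc p)).
have Yreg : regular Y n (R^o : lmodType R).
  apply: regular_loc_xpow; [exact: loc_shift_inj | exact: loc_shift_frac |].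
  exact: loc_shift_unit.
have bX i : (\sum_j b j *: partial k j) 'X_i = b i by exact: partial_coord.
have blog : \sum_j b j *: partial k j \in derlog_pred f.
  by apply/derlog_predP; exists u; rewrite der_sumE -ufE mulrC.
exists (Sub (\sum_j b j *: partial k j) blog : derlog f) => x; have /derlog_predP[g xf] := valP x.
(* Let b be the derivation with coefficients [b]. As b(f) = u f and x(f) = f g, u x - g b kills [f]:
   its coefficients are a syzygy of the partials alone. *)
pose c (i : 'I_n) := u * val x 'X_i - g * b i.
have cF : \sum_i c i * f^`M(i) = 0.
  under eq_bigr do rewrite mulrBl -!mulrA.
  by rewrite sumrB -!mulr_sumr -der_partialE xf -ufE; ring.
have dvec : contract FR (vec n (fun l => loc p (ordfam c 0 l))) = 0.
  rewrite contract_vec -[RHS](scale0r (ext_one R n)); congr (_ *: _).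
  rewrite -[RHS](rmorph0 (loc p)) -cF rmorph_sum; apply: eq_bigr => i _.
  by rewrite ordfamE der_gens_lt rmorphM.
(* There are only n generators here, so vanishing already starts in degree 1. *)
have [||||w] := @koszul_vanish R Y FR n n Yreg YF 0 1 (vec n (fun l => loc p (ordfam c 0 l))).
- by [].
- by rewrite addn0 addn1.
- by rewrite degpart_vec.
- exact: dvec.
move=> wE; have {}wE : vec n (fun l => loc p (ordfam c 0 l)) = contract FR w.
  by apply/eqP; rewrite -subr_eq0; apply/eqP.
have [t tE] := boundary_antisym FR w.
have tc (i : 'I_n) : loc p (c i) = \sum_(j < n) (t i j - t j i) * loc p f^`M(j).
  have := congr1 (@degpart R 1 n) wE; rewrite degpart_vec tE => /vec_inj/(_ i (ltn_ord i)).
  rewrite ordfamE => ->; apply: eq_bigr => j _; by rewrite der_gens_lt.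
have [s [T [s0 sT]]] := loc_denom (fun ij : 'I_n * 'I_n => t ij.1 ij.2).
exists (s * u), (s * g); split; first by rewrite mevalM mulf_neq0.
apply: (@antisym_span _ _ f _ (fun i j => T (i, j))) => i.
rewrite derlog_addE -[- (_ *: _)]scaleNr !derlog_scaleE SubK bX.
apply: (@loc_inj _ _ p).
have -> : s * u * val x 'X_i + - (s * g) * b i = s * c i by rewrite /c; ring.
rewrite rmorphM /= tc mulr_sumr rmorph_sum; apply: eq_bigr => j _.
by rewrite rmorphM rmorphB /= -(sT (i, j)) -(sT (j, i)) -mulrBr mulrA.
Qed.

Lemma loc_point_yspan a : a.@[p] = 0 ->
  @yspan R (loc_xpow (loc_shift p) 1) R^o n (loc p a).
Proof.
move=> a0; have : a \in (P : {pred S}) by rewrite mem_point_ideal a0.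
move=> /gen_idealP[r [c [b [bE ->]]]]; rewrite rmorph_sum.
apply: (@yspan_sum R _ R^o) => i _; have [j ->] := bE i.
rewrite rmorphM /= mulrC -[loc p ('X_j - _)]expr1 -loc_shift_xpow.
exact: (@yspan_gen R _ R^o).
Qed.

Lemma cyclic_quasihomogeneous : locally_cyclic -> quasihomogeneous_at p f.
Proof.
move=> [x0 x0E]; have /derlog_predP[g0 x0f] := valP x0.
apply/quasihomogeneousP.
(* If g0 is nonzero at p, then x0(f) = f g0 already puts [f] in the local Jacobian ideal. *)
have [g0p|g0p] := eqVneq g0.@[p] 0; last first.
  exists g0, (fun i => val x0 'X_i); split=> //.
  by rewrite -der_partialE x0f mulrC.
exfalso.
have [N N0 Nsing] := loc_xpow_singular.
(* [Y] lies in the singular ideal and serves vanishing and duality; [X] generates the maximal ideal,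
   modulo which the differential is reduced. *)
pose X := loc_xpow (loc_shift p) 1; pose Y := loc_xpow (loc_shift p) N.
have reg e : regular (loc_xpow (loc_shift p) e) n (R^o : lmodType R).
  apply: regular_loc_xpow; [exact: loc_shift_inj | exact: loc_shift_frac |].
  exact: loc_shift_unit.
have YF i : (i < n)%N -> genby FR n.+1 (Y i).
  move=> /Nsing; apply: locideal_genby => a; exact: (singular_genby (loc p)).
pose a0 : nat -> S := ordfam (fun i => val x0 'X_i) (- g0).
pose a l := loc p (a0 l).
have aF : \sum_(l < n.+1) a l * FR l = 0.
  rewrite big_ord_recr /= /a /a0 ordfam_ge // der_gens_last.
  under eq_bigr do rewrite ordfamE der_gens_lt -rmorphM.
  rewrite -rmorph_sum -der_partialE x0f -rmorphM -rmorphD /=.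
  by rewrite mulNr mulrC subrr rmorph0.
have cyc (c : nat -> R) : \sum_(l < n.+1) c l * FR l = 0 ->
    exists r w, vec n.+1 c = r *: vec n.+1 a + contract FR w.
  move=> cF; have [s [C [s0 sC]]] := loc_denom (fun l : 'I_n.+1 => c l).
  have CF : \sum_(l < n.+1) C l * F l = 0.
    apply: (@loc_inj _ _ p); rewrite rmorph0 rmorph_sum.
    rewrite -[RHS](mulr0 (loc p s)) -[in RHS]cF mulr_sumr; apply: eq_bigr => l _.
    by rewrite rmorphM /= -sC mulrA.
  pose d : der S := \sum_(i < n) C (widen_ord (leqnSn n) i) *: partial k i.
  have df : d f = - (f * C ord_max).
    rewrite der_sumE; move: CF; rewrite big_ord_recr /= der_gens_last.
    under eq_bigr do rewrite der_gens_lt.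
    by move=> /eqP; rewrite addr_eq0 mulrC => /eqP.
  have dlog : d \in derlog_pred f.
    by apply/derlog_predP; exists (- C ord_max); rewrite mulrN.
  pose x : derlog f := Sub d dlog.
  have [u [b [u0 xK]]] := x0E x.
  (* u x - b x0 sends [f] to - f (u C_n + b g0), whence the last entry [q]. *)
  have [|w wE] := span_boundary f_neq0 (loc p) (q := u * C ord_max + b * g0) xK.
    rewrite derlog_addE -[- (_ *: _)]scaleNr !derlog_scaleE SubK df x0f; ring.
  have us0 : (u * s).@[p] != 0 by rewrite mevalM mulf_neq0.
  have [v vus] := loc_unit us0.
  exists (v * loc p b), (v *: w).
  rewrite contractZ -wE -(vecZ _ v) -vecZD; apply: eq_wedge => l ln.
  have sCl := sC (Ordinal ln); rewrite /= in sCl.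
  have cE : c l = v * (loc p u * loc p (C (Ordinal ln))).
    by rewrite -sCl -[LHS]mul1r -vus rmorphM /=; ring.
  have {}cE : c l = v * loc p b * a l + v * loc p (u * C (Ordinal ln) - b * a0 l).
    by rewrite cE rmorphB !rmorphM /a /=; ring.
  rewrite cE; congr (_ + _ * loc p _); rewrite /a0.
  case: (der_gens_cases ln) => [[i il]|lN].
    have -> : Ordinal ln = widen_ord (leqnSn n) i by apply: val_inj.
    rewrite il !ordfamE derlog_addE -[- (_ *: _)]scaleNr !derlog_scaleE SubK.
    by rewrite partial_coord mulNr.
  have -> : Ordinal ln = ord_max by apply: val_inj.
  by rewrite lN !ordfam_ge // mulrN opprK.
have dual (r : R) : ~ genby FR n.+1 r ->
    exists t, (forall l, (l < n.+1)%N -> @yspan R Y R^o n (t * FR l)) /\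
      ~ @yspan R Y R^o n (t * r).
  apply: (@loc_xpow_dual k n R (loc_shift p)) => //.
  - exact: loc_shift_inj.
  - exact: loc_shift_frac.
  - exact: loc_shift_unit.
have one := @no_cyclic_first_homology R n n.+1 X Y FR a (erefl _) (reg N) YF aF cyc dual (reg 1).
have {one} : @yspan R X R^o n 1.
  apply: one => l ln; apply: loc_point_yspan; first exact: singular_at_point.
  rewrite /a0; case: (der_gens_cases ln) => [[i ->]|->].
    by rewrite ordfamE derlog_vanish.
  by rewrite ordfam_ge // mevalN g0p oppr0.
(* Clearing denominators puts a polynomial with nonzero constant term into the ideal of the X_i, but
   no X_i divides the constant monomial. *)
move=> /(yspan_frac (@loc_shift_frac _ _ p))[s [b [s0]]].
rewrite mulr1 => /loc_shift_inj <- /(yspan_xpow _ _ (leqnn n)).1 /(_ 0%MM).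
rewrite mcoeff_msupp => /(_ s0) /existsP[i].
by rewrite mnm0E andbF.
Qed.

End LocalHypersurface.

Theorem theorem4p4 (k : fieldType) (k_char0 : [pchar k] =i pred0)
    (n : nat) (n_ge2 : (2 <= n)%N) (f : {mpoly k[n]}) (f_neq0 : f != 0) :
  (smooth_hypersurface f <-> forall e : essder f, e = 0) /\
  (forall p : 'I_n -> k, isolated_singular_point p f ->
     (quasihomogeneous_at p f <->
      cyclic_module (locmod (point_ideal p) (essder f)))).
Proof.
have class0 (x : derlog f) : essder_class x = 0 <-> x \in Defs.span (@koszul k n f).
  have -> : 0 = essder_class (0 : derlog f).
    by rewrite -(scale0r (essder_class (0 : derlog f))) essder_classZ scale0r.
  by rewrite essder_class_eq subr0.
split.
  split=> [sm e|e0].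
    by have [x ->] := essder_classP e; apply/class0/smooth_essder.
  by apply: essder0_smooth => // x; apply/class0/e0.
move=> p fp; split=> [qh|cyc].
  exact/cyclic_essderP/quasihomogeneous_cyclic.
exact/cyclic_quasihomogeneous/cyclic_essderP.
Qed.
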